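(* Let $X$ be a complex manifold of dimension $3$. Then for every $m\geq 0$ the graded bundle of the bundle $E_{3,m}T_X^*$ of invariant jet differentials of order $3$ and degree $m$ decomposes as $$Gr^{\bullet}E_{3,m}T_X^*=\bigoplus_{0\le\gamma\le \frac m5}\ \Bigg(\bigoplus_{\substack{\lambda_1+2\lambda_2+3\lambda_3=m-\gamma\\ \lambda_i-\lambda_j\ge\gamma\ \text{for } i<j}}\Gamma^{(\lambda_1,\lambda_2,\lambda_3)}T_X^*\Bigg),$$ where $\gamma$ runs over integers, $(\lambda_1,\lambda_2,\lambda_3)$ runs over triples of integers with $\lambda_3\geq 0$, and $\Gamma$ is the Schur functor.
   Context: For a complex manifold $X$ of dimension $n$, $E_{k,m}T_X^*$ is the bundle of invariant jet differentials of order $k$ and degree $m$ (Demailly–Semple). Its fibre at $x$ consists of the complex polynomials $Q(f',f'',\dots,f^{(k)})$ in the derivatives at $0$ of germs $f:(\mathbb{C},0)\to (X,x)$ such that $Q((f\circ\phi)',\dots,(f\circ\phi)^{(k)})=\phi'(0)^m Q(f',\dots,f^{(k)})$ for every $k$-jet of germ of biholomorphism $\phi$ of $(\mathbb{C},0)$. It carries a canonical filtration induced from the filtration of all weighted homogeneous jet differentials of weight $m$ (obtained by successively filtering by the degree in the highest-order derivative), and its graded bundle is $$Gr^{\bullet}E_{k,m}T_X^*=\Big(\bigoplus_{l_1+2l_2+\dots+kl_k=m}S^{l_1}T_X^*\otimes S^{l_2}T_X^*\otimes\cdots\otimes S^{l_k}T_X^*\Big)^{G_k'},$$ where $G_k'$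 is the group of $k$-jets of reparametrizations $\phi(t)=t+b_2t^2+\dots+b_kt^k$. For $k=3$, elements of the sum in the fibre at $x$ are polynomials in $(f',f'',f''')\in T_{X,x}^3$ and $G_3'$ acts by $f'\mapsto f'$, $f''\mapsto f''+2b_2f'$, $f'''\mapsto f'''+6b_2f''+6b_3f'$. For a vector space $V$ of dimension $r$ and integers $a_1\ge\dots\ge a_r\ge0$, $\Gamma^{(a_1,\dots,a_r)}V$ is the irreducible polynomial representation of $GL(V)$ of highest weight $(a_1,\dots,a_r)$ (so $\Gamma^{(k,0,\dots,0)}V=S^kV$ and $\Gamma^{(1,\dots,1)}V=\det V$), applied fibrewise to vector bundles. *)

(* Defs.v *)
From HB Require Import structures.
From mathcomp Require Import all_boot all_order all_algebra.
From mathcomp Require Import complex.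
From mathcomp Require Import boolp classical_sets functions reals.
From mathcomp Require Import topology normedtype derive.

Set Implicit Arguments.
Unset Strict Implicit.
Unset Printing Implicit Defensive.

Import Order.TTheory GRing.Theory Num.Theory.
Import numFieldNormedType.Exports.

Local Open Scope classical_set_scope.
Local Open Scope ring_scope.

(* R[i] carries its topology and norm through its numClosedFieldType
   structure, hence this alias. *)
Definition Cplx (R : realType) : numClosedFieldType := complex R.

(* Since the base field is Cplx R, [differentiable] means complex
   differentiable, so it expresses holomorphy when required on an open set.
   Only the values of [chart_map] on [chart_dom], and those of [chart_inv] on
   its image, matter. *)
Record complex_threefold (R : realType) := ComplexThreefold {
  mspace :> topologicalType;
  hausdorff_mspace : hausdorff_space mspace;
  second_countable_mspace : @second_countable mspace;
  chart : Type;
  chart_dom : chart -> set mspace;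
  chart_map : chart -> mspace -> 'rV[Cplx R]_3;
  chart_inv : chart -> 'rV[Cplx R]_3 -> mspace;
  chart_dom_open : forall i, open (chart_dom i);
  chart_cover : forall x, exists i, chart_dom i x;
  chart_img_open : forall i, open (chart_map i @` chart_dom i);
  chart_mapK : forall i x, chart_dom i x -> chart_inv i (chart_map i x) = x;
  chart_map_continuous : forall i,
    {within chart_dom i, continuous (chart_map i)};
  chart_inv_continuous : forall i,
    {within chart_map i @` chart_dom i, continuous (chart_inv i)};
  chart_transition : forall i j x, chart_dom i x -> chart_dom j x ->
    differentiable (chart_map j \o chart_inv i) (chart_map i x) }.

Section Bundles.
Variables (R : realType) (X : complex_threefold R).
Local Notation C := (Cplx R).

Definition transition (i j : chart X) : 'rV[C]_3 -> 'rV[C]_3 :=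
  chart_map j \o chart_inv i.

Definition holomorphic_in (i : chart X) (u : X -> C) : Prop :=
  forall x, chart_dom i x ->
    differentiable (u \o chart_inv i : 'rV[C]_3 -> C^o) (chart_map i x).

(* A vector bundle trivialised over the charts, with typical fibre the column
   vectors: coordinates of a same vector over charts i and j are related by
   v_i = cc_trans i j x *m v_j. *)
Record cocycle_bundle := CocycleBundle {
  cc_rank : nat;
  cc_trans : chart X -> chart X -> X -> 'M[C]_cc_rank }.

(* In row coordinates a tangent vector satisfies v_j = v_i *m 'J(transition i j),
   so the column coordinates xi of a covector v |-> v_i *m xi_i satisfy
   xi_i = 'J(transition i j) *m xi_j. *)
Definition cotangent : cocycle_bundle :=
  @CocycleBundle 3 (fun i j x => jacobian (transition i j) (chart_map i x)).

Definition dsum_bundle (N : nat) (E : 'I_N -> cocycle_bundle) :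
    cocycle_bundle :=
  @CocycleBundle (\sum_(k < N) cc_rank (E k))%N
    (fun i j x => \mxdiag_(k < N) cc_trans (E k) i j x).

(* A vector bundle trivialised over the charts, with typical fibre the quotient
   of the subspace sq_num by its subspace sq_den: elements Q_i and Q_j
   represent the same vector over charts i and j when Q_i = sq_trans i j x Q_j
   modulo sq_den. *)
Record subquotient_bundle := SubquotientBundle {
  sq_mod : lmodType C;
  sq_num : set sq_mod;
  sq_den : set sq_mod;
  sq_trans : chart X -> chart X -> X -> sq_mod -> sq_mod }.

(* Isomorphism of holomorphic vector bundles: over each chart, a holomorphic
   family of linear isomorphisms sq_num / sq_den -> 'cV_r, compatible with the
   changes of charts. *)
Definition bundle_isom (E : subquotient_bundle) (F : cocycle_bundle) : Prop :=
  exists h : chart X -> X -> sq_mod E -> 'cV[C]_(cc_rank F),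
  [/\ forall i x, chart_dom i x ->
        [/\ forall (a : C) (Q Q' : sq_mod E), sq_num Q -> sq_num Q' ->
              h i x (a *: Q + Q') = a *: h i x Q + h i x Q',
            forall Q, sq_num Q -> (h i x Q = 0 <-> sq_den Q)
          & forall v, exists2 Q, sq_num Q & h i x Q = v],
      forall i j x, chart_dom i x -> chart_dom j x -> forall Q, sq_num Q ->
        h i x (sq_trans i j x Q) = cc_trans F i j x *m h j x Q
    & forall i Q, sq_num Q -> forall k : 'I_(cc_rank F),
        holomorphic_in i (fun x => h i x Q k 0)].

End Bundles.

Section Polynomials.
Variables (R : realType) (p q : nat).
Local Notation C := (Cplx R).

Definition monomial (e : 'M[nat]_(p, q)) (A : 'M[C]_(p, q)) : C :=
  \prod_(i < p) \prod_(j < q) A i j ^+ e i j.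

(* P is a polynomial function of the entries, all of whose monomials have an
   exponent in D. *)
Definition polynomial_in (D : pred 'M[nat]_(p, q)) (P : 'M[C]_(p, q) -> C) :
    Prop :=
  exists2 s : seq (C * 'M[nat]_(p, q)), all (fun t => D t.2) s &
    forall A, P A = \sum_(t <- s) t.1 * monomial t.2 A.

Definition polynomial_fun : ('M[C]_(p, q) -> C) -> Prop :=
  polynomial_in xpredT.

End Polynomials.

Section Representations.
Variables (R : realType) (r : nat).
Local Notation C := (Cplx R).

(* GL_r acts on column vectors; the values of gl_act outside unitmx are
   irrelevant. *)
Record gl_module := GLModule {
  gl_dim : nat;
  gl_act : 'M[C]_r -> 'M[C]_gl_dim }.

Definition polynomial_rep (V : gl_module) : Prop :=
  [/\ gl_act V 1%:M = 1%:M,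
      forall A B, A \in unitmx -> B \in unitmx ->
        gl_act V (A *m B) = gl_act V A *m gl_act V B
    & forall a b, exists2 P : 'M[C]_r -> C, polynomial_fun P &
        forall A, A \in unitmx -> gl_act V A a b = P A].

(* Subspaces of column vectors are encoded as row spaces of matrices, hence
   the transpositions. *)
Definition irreducible_rep (V : gl_module) : Prop :=
  (0 < gl_dim V)%N /\
  forall U : 'M[C]_(gl_dim V),
    (forall A, A \in unitmx -> stablemx U (gl_act V A)^T) ->
    U != 0 -> row_full U.

(* A nonzero vector on which the upper triangular matrices act through the
   character lambda. *)
Definition has_highest_weight (l : 'I_r -> nat) (V : gl_module) : Prop :=
  exists2 v : 'cV[C]_(gl_dim V), v != 0 &
    forall A : 'M[C]_r, A \in unitmx -> is_trig_mx A^T ->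
      gl_act V A *m v = (\prod_(k < r) A k k ^+ l k) *: v.

Definition dominant (l : 'I_r -> nat) : Prop :=
  forall i j : 'I_r, (i <= j)%N -> (l j <= l i)%N.

(* Gamma is a choice, for each dominant weight, of the irreducible polynomial
   representation with that highest weight. *)
Definition schur_functors (Gamma : ('I_r -> nat) -> gl_module) : Prop :=
  forall l, dominant l ->
    [/\ polynomial_rep (Gamma l), irreducible_rep (Gamma l)
      & has_highest_weight l (Gamma l)].

End Representations.

(* Applies fibrewise a representation of GL_r to a bundle of rank r. *)
Definition apply_rep (R : realType) (X : complex_threefold R)
    (E : cocycle_bundle X) (V : gl_module R (cc_rank E)) : cocycle_bundle X :=
  @CocycleBundle R X (gl_dim V) (fun i j x => gl_act V (cc_trans E i j x)).

Section Jets.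
Variables (R : realType).
Local Notation C := (Cplx R).

(* The 3-jet of a germ of curve f, read in a chart, is the matrix F whose rows
   are f', f'' and f''' at 0. *)
Local Notation jet := 'M[C]_3.

Definition jet_rows (u1 u2 u3 : 'rV[C]_3) : jet :=
  \matrix_(k < 3) nth 0 [:: u1; u2; u3] k.

(* The jet of f o phi when phi has derivatives a1, a2, a3 at 0. For
   phi(t) = t + b2 t^2 + b3 t^3, one has a1 = 1, a2 = 2 b2 and a3 = 6 b3. *)
Definition reparam (a1 a2 a3 : C) (F : jet) : jet :=
  jet_rows (a1 *: row 0 F)
           (a1 ^+ 2 *: row 1 F + a2 *: row 0 F)
           (a1 ^+ 3 *: row 2 F + (3%:R * a1 * a2) *: row 1 F
            + a3 *: row 0 F).

Definition invariant_jet_differential (m : nat) (Q : jet -> C) : Prop :=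
  polynomial_fun Q /\
  forall (a1 a2 a3 : C) (F : jet), a1 != 0 ->
    Q (reparam a1 a2 a3 F) = a1 ^+ m * Q F.

Definition partial (a : 'I_3) (t : 'rV[C]_3 -> 'rV[C]_3) :
    'rV[C]_3 -> 'rV[C]_3 :=
  fun p => 'D_(delta_mx 0 a) t p.

(* The jet of t o f at 0 when f has jet F at f(0) = p, obtained by
   differentiating t o f three times. *)
Definition jet_image (t : 'rV[C]_3 -> 'rV[C]_3) (p : 'rV[C]_3) (F : jet) :
    jet :=
  jet_rows
    (\sum_a F 0 a *: partial a t p)
    (\sum_a F 1 a *: partial a t p
     + \sum_a \sum_b (F 0 a * F 0 b) *: partial a (partial b t) p)
    (\sum_a F 2 a *: partial a t p
     + 3%:R *: (\sum_a \sum_b (F 0 a * F 1 b) *: partial a (partial b t) p)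
     + \sum_a \sum_b \sum_c
         (F 0 a * F 0 b * F 0 c) *: partial a (partial b (partial c t)) p).

(* Degree of a monomial in the k-th row, i.e. in the derivative of order
   k + 1. *)
Definition row_degree (k : 'I_3) (e : 'M[nat]_3) : nat := (\sum_(j < 3) e k j)%N.

Definition lex_lt (a b : nat * nat) : bool :=
  (a.1 < b.1)%N || ((a.1 == b.1) && (a.2 < b.2)%N).
Definition lex_le (a b : nat * nat) : bool := (a == b) || lex_lt a b.

(* Filtering by the degree in f''', and then by the degree in f'', amounts to
   filtering by these two degrees ordered lexicographically. For invariant jet
   differentials of degree m the degree in f' is then determined by the
   weight. *)
Definition jet_filtration (l : nat * nat) (Q : jet -> C) : Prop :=
  polynomial_in (fun e => lex_le (row_degree 2 e, row_degree 1 e) l) Q.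
Definition jet_filtration_lt (l : nat * nat) (Q : jet -> C) : Prop :=
  polynomial_in (fun e => lex_lt (row_degree 2 e, row_degree 1 e) l) Q.

(* The graded bundle, i.e. the direct sum over l = (l3, l2) of the quotients
   F_l / F_{<l} for the filtration induced on E_{3,m}. Both degrees are at most
   m by homogeneity. The coordinate change Q_i = Q_j o jet_image is that of
   E_{3,m} itself. *)
Definition graded_jet_bundle (X : complex_threefold R) (m : nat) :
    subquotient_bundle X :=
  @SubquotientBundle R X ('I_m.+1 * 'I_m.+1 -> jet -> C^o)
    [set Q | forall l : 'I_m.+1 * 'I_m.+1,
               invariant_jet_differential m (Q l) /\
               jet_filtration (l.1 : nat, l.2 : nat) (Q l)]
    [set Q | forall l : 'I_m.+1 * 'I_m.+1,
               invariant_jet_differential m (Q l) /\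
               jet_filtration_lt (l.1 : nat, l.2 : nat) (Q l)]
    (fun i j x Q l F => Q l (jet_image (transition i j) (chart_map i x) F)).

End Jets.

(* The pairs (gamma, lambda) indexing the decomposition; the bounds lambda_i <= m
   follow from the weight equation. *)
Definition schur_index (m : nat) :
    {set 'I_(m %/ 5).+1 * {ffun 'I_3 -> 'I_m.+1}} :=
  [set gl : 'I_(m %/ 5).+1 * {ffun 'I_3 -> 'I_m.+1} |
            ((\sum_(i < 3) i.+1 * gl.2 i)%N == (m - gl.1)%N) &&
            [forall i : 'I_3, forall j : 'I_3,
               (i < j)%N ==> (gl.2 j + gl.1 <= gl.2 i)%N]].

(* The double sum of the decomposition, as a single direct sum over the pairs
   (gamma, lambda). *)
Definition schur_sum (R : realType) (X : complex_threefold R)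
    (Gamma : ('I_3 -> nat) -> gl_module R 3) (m : nat) : cocycle_bundle X :=
  dsum_bundle (fun k : 'I_#|schur_index m| =>
    apply_rep (E := cotangent X)
      (Gamma (fun a => (enum_val k).2 a : nat))).

(* Main.v *)
Require Import Defs.
From HB Require Import structures.
From mathcomp Require Import all_boot all_order all_algebra.
From mathcomp Require Import complex.
From mathcomp Require Import boolp classical_sets functions reals.
From mathcomp Require Import topology normedtype derive.
From mathcomp Require Import ring zify.

Set Implicit Arguments.
Unset Strict Implicit.
Unset Printing Implicit Defensive.

Import Order.TTheory GRing.Theory Num.Theory.
Import numFieldNormedType.Exports.

(** Read in a chart, a 3-jet of curve is a 3 x 3 matrix F with rows f', f'', f'''.
    The group GL_3 acts on polynomials in F by (A.Q)(F) = Q (F A), and a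
    reparametrization multiplies F on the left by a lower triangular matrix
    ([reparam_mx]). Up to terms of lower order for the filtration, a change of
    coordinates with Jacobian matrix J acts on the jets by F |-> F J
    ([jet_image_same_lead]), so the changes of charts of the graded bundle only
    involve the representation of GL_3 on its fibre. An isomorphism with the sum
    of Schur functors is then given by one linear map, the same at each point of
    each chart.

    The space E_m of invariant polynomials of degree m decomposes without
    multiplicity. Let x be the first coordinate of f', w the Wronskian of the
    first two coordinates, q = x w' - 3 x' w and D = det F. When x, w, q and D do
    not vanish, F is brought to a fixed matrix by a reparametrization and an upper
    triangular matrix. Hence a highest weight vector of weight l in E_m is a
    multiple of x^(l0 - l1 - g) w^(l1 - l2 - g) q^g D^l2 with
    g = m - l0 - 2 l1 - 3 l2 ([invariant_jet_value]). Such a function has no pole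
    along q = 0, x = 0 and w = 0 exactly when g >= 0, g <= l0 - l1 and
    g <= l1 - l2 ([invariant_jet_weight_bounds], [highest_weight_jet_invariant]):
    these are the inequalities of the index set, g being gamma.

    Complete reducibility comes from an inner product on polynomials of bounded
    degree for which the translations by A and by its adjoint are adjoint to each
    other ([kernel_form_right], [kernel_form_left]), together with the existence
    of a highest weight vector in each stable subspace ([highest_weight_vector]).
    Applied to left translations, these two facts show that a polynomial P with
    P (F B) = chi_l(B) P(F) for B upper triangular is a matrix coefficient
    xi (rho F) v of the given irreducible representation of highest weight l, with
    highest weight vector v ([semi_invariant_matrix_coef]); the map
    u |-> xi (rho F) u then embeds this representation into E_m
    ([jet_embedding_exists]). Applied to right translations, they show that E_m is
    the orthogonal sum of the images ([embeddings_orthogonal],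
    [invariant_jet_decomposition]) and that a stable subspace contains every
    component on which it does not project to zero ([embed_sub]). The filtration
    therefore cuts E_m along whole components: each one appears in exactly one
    step ([is_level]), and the projections of the graded pieces onto the
    components of their step form the required isomorphism. *)

Local Open Scope ring_scope.

(** * Subspaces and orthogonal projections *)

Section Subspaces.
Variables (K : numClosedFieldType) (W : lmodType K).
Implicit Types (Y : W -> Prop) (form : W -> W -> K).

Definition subspace Y : Prop :=
  Y 0 /\ forall (a : K) P Q, Y P -> Y Q -> Y (a *: P + Q).

Lemma subspaceD Y P Q : subspace Y -> Y P -> Y Q -> Y (P + Q).
Proof. by move=> [_ hY] hP hQ; rewrite -[P]scale1r; apply: hY. Qed.

Lemma subspaceZ Y a P : subspace Y -> Y P -> Y (a *: P).
Proof. by move=> [h0 hY] hP; rewrite -[_ *: _]addr0; apply: hY. Qed.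

Lemma subspaceB Y P Q : subspace Y -> Y P -> Y Q -> Y (P - Q).
Proof. by move=> sY hP hQ; rewrite -scaleN1r addrC; apply: sY.2. Qed.

Lemma subspace_sum Y (I : Type) (s : seq I) (D : pred I) (P : I -> W) :
  subspace Y -> (forall i, D i -> Y (P i)) -> Y (\sum_(i <- s | D i) P i).
Proof.
by move=> sY hP; apply: (big_ind Y) => //; [exact: sY.1 | move=> *; exact: subspaceD].
Qed.

Lemma subspaceI Y Y' :
  subspace Y -> subspace Y' -> subspace (fun P => Y P /\ Y' P).
Proof.
move=> sY sY'; split; first by split; [exact: sY.1 | exact: sY'.1].
by move=> a P Q [? ?] [? ?]; split; [apply: sY.2 | apply: sY'.2].
Qed.

(** The combination g(2t) - 2^n g(t) of g(t) = \sum_k t^k P_k has no term of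
    degree n, so the degree can be lowered until each coefficient is isolated. *)
Lemma subspace_coef Y n (P : nat -> W) : subspace Y ->
  (forall t : K, t != 0 -> Y (\sum_(k < n) t ^+ k *: P k)) ->
  forall k, (k < n)%N -> Y (P k).
Proof.
move=> sY; elim: n P => [//|n IHn] P hP.
have two0 : (2 : K) != 0 by rewrite pnatr_eq0.
have hlow k : (k < n)%N -> Y (P k).
  move=> ltkn.
  have/(_ k ltkn) hk : forall k, (k < n)%N -> Y ((2 ^+ k - 2 ^+ n) *: P k).
    apply: (IHn (fun k => (2 ^+ k - 2 ^+ n) *: P k)) => t t0.
    have -> : \sum_(i < n) t ^+ i *: ((2 ^+ i - 2 ^+ n) *: P i) =
      \sum_(i < n.+1) (2 * t) ^+ i *: P i
      - 2 ^+ n *: (\sum_(i < n.+1) t ^+ i *: P i).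
      rewrite !big_ord_recr /= scalerDr opprD addrACA scalerA exprMn subrr addr0.
      rewrite scaler_sumr -sumrB; apply: eq_bigr => i _.
      by rewrite !scalerA -scalerBl exprMn; congr (_ *: _); ring.
    apply: subspaceB => //; first by apply: hP; rewrite mulf_neq0.
    by apply: subspaceZ => //; apply: hP.
  have nz : (2 : K) ^+ k - 2 ^+ n != 0.
    rewrite subr_eq0; apply: contraTneq ltkn => /eqP.
    by rewrite -!natrX eqr_nat eqn_exp2l // => /eqP ->; rewrite ltnn.
  by rewrite -[P k]scale1r -(mulVf nz) -scalerA; apply: subspaceZ.
move=> k; rewrite ltnS leq_eqVlt => /orP[/eqP->|]; last exact: hlow.
have := hP 1 (oner_neq0 _); rewrite big_ord_recr /= expr1n scale1r.
set S := \sum_(_ < _) _ => hS.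
have -> : P n = (S + P n) - S by rewrite addrAC subrr add0r.
apply: subspaceB => //; apply: subspace_sum => // i _.
by apply: subspaceZ => //; apply: hlow.
Qed.

Definition finite_span Y : Prop :=
  exists (T : finType) (b : T -> W),
    forall P, Y P -> exists c : T -> K, P = \sum_f c f *: b f.

Definition hermitian_on Y form : Prop :=
  [/\ forall a P P' Q, form (a *: P + P') Q = a * form P Q + form P' Q,
      forall P Q, Y P -> Y Q -> form P Q = (form Q P)^*
    & forall P, Y P -> form P P = 0 -> P = 0].

Lemma form0l Y form Q : hermitian_on Y form -> form 0 Q = 0.
Proof.
case=> hl _ _; have := hl (-1) 0 0 Q.
by rewrite scaler0 addr0 mulN1r addNr.
Qed.

Lemma formBl Y form P P' Q : hermitian_on Y form ->
  form (P - P') Q = form P Q - form P' Q.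
Proof.
by case=> hl _ _; rewrite -scaleN1r addrC hl mulN1r addrC.
Qed.

Lemma formDl Y form P P' Q : hermitian_on Y form ->
  form (P + P') Q = form P Q + form P' Q.
Proof. by case=> hl _ _; rewrite -[P]scale1r hl mul1r scale1r. Qed.

Lemma formZl Y form a P Q : hermitian_on Y form ->
  form (a *: P) Q = a * form P Q.
Proof.
by move=> hf; case: (hf) => hl _ _; rewrite -[_ *: _]addr0 hl (form0l _ hf) addr0.
Qed.

Lemma form_suml Y form (I : Type) (s : seq I) (P : I -> W) Q :
  hermitian_on Y form ->
  form (\sum_(i <- s) P i) Q = \sum_(i <- s) form (P i) Q.
Proof.
move=> hf; elim: s => [|i s IHs]; first by rewrite !big_nil (form0l _ hf).
by rewrite !big_cons (formDl _ _ _ hf) IHs.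
Qed.

Lemma form_eq0C Y form P Q : hermitian_on Y form -> Y P -> Y Q ->
  form P Q = 0 -> form Q P = 0.
Proof. by case=> _ hc _ hP hQ h0; rewrite hc // h0 conjC0. Qed.

Lemma formDr Y form P Q Q' : subspace Y -> hermitian_on Y form ->
  Y P -> Y Q -> Y Q' -> form P (Q + Q') = form P Q + form P Q'.
Proof.
move=> sY hf hP hQ hQ'; have [_ hc _] := hf.
rewrite hc //; last exact: subspaceD.
by rewrite (hc P Q) // (hc P Q') // (formDl _ _ _ hf) rmorphD.
Qed.

Lemma formZr Y form a P Q : subspace Y -> hermitian_on Y form ->
  Y P -> Y Q -> form P (a *: Q) = a^* * form P Q.
Proof.
move=> sY hf hP hQ; have [_ hc _] := hf.
rewrite hc //; last exact: subspaceZ.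
by rewrite (hc P Q) // (formZl _ _ _ hf) rmorphM.
Qed.

Fixpoint ortho_frame Y form (ys : seq W) : Prop :=
  if ys is y :: ys' then
    [/\ Y y, y <> 0, forall z, z \in ys' -> form y z = 0 & ortho_frame Y form ys']
  else True.

Lemma ortho_frame_sub Y form ys y :
  ortho_frame Y form ys -> y \in ys -> Y y.
Proof.
elim: ys => [//|z ys IHys] /= [hz _ _ hys]; rewrite inE => /orP[/eqP->//|].
exact: IHys.
Qed.

Lemma ortho_frame_nth Y form ys i j : hermitian_on Y form ->
  ortho_frame Y form ys -> (i < size ys)%N -> (j < size ys)%N ->
  (form (nth 0 ys i) (nth 0 ys j) = 0) <-> (i != j).
Proof.
move=> hf; elim: ys i j => [//|y ys IHys] [|i] [|j] //= hys.
- case: hys => hy y0 _ _ _ _; split => // hyy.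
  by case: y0; case: hf => _ _ hd; apply: hd.
- by case: hys => _ _ hyz _ _ hj; split => // _; apply: hyz; apply: mem_nth.
- case: hys => hy _ hyz hys hi _; split => // _.
  by apply: (form_eq0C hf) => //; [apply: (ortho_frame_sub hys) | apply: hyz];
     apply: mem_nth.
- by case: hys => _ _ _ hys hi hj; rewrite eqSS; apply: IHys.
Qed.

(** Orthogonal nonzero vectors are linearly independent. *)
Lemma ortho_frame_size Y form : hermitian_on Y form ->
  subspace Y -> finite_span Y ->
  exists N, forall ys, ortho_frame Y form ys -> (size ys <= N)%N.
Proof.
move=> hf sY [T [b hb]]; exists #|T| => ys hys; rewrite leqNgt; apply/negP => hlt.
have hY i : exists c : T -> K, (i < size ys)%N -> nth 0 ys i = \sum_f c f *: b f.
  have [hi|hi] := boolP (i < size ys)%N; last by exists (fun _ => 0).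
  have [|c hc] := hb (nth 0 ys i); last by exists c.
  by apply: (ortho_frame_sub hys); apply: mem_nth.
have [c hc] := choice hY.
pose M : 'M[K]_(size ys, #|T|) := \matrix_(i, f) c i (enum_val f).
have : kermx M != 0.
  rewrite kermx_eq0; apply: contraL hlt => /eqP hr; rewrite -leqNgt -hr.
  exact: rank_leq_col.
case/rowV0Pn => a /sub_kermxP haM /negP; apply; apply/eqP/rowP => i; rewrite mxE.
have hsum : \sum_(j < size ys) a 0 j *: nth 0 ys j = 0.
  under eq_bigr => j _ do rewrite hc // scaler_sumr.
  rewrite exchange_big /=; apply: big1 => f _.
  under eq_bigr => j _ do rewrite scalerA.
  rewrite -scaler_suml; have := congr1 (fun v : 'rV_ _ => v 0 (enum_rank f)) haM.
  rewrite !mxE; under eq_bigr => j _ do rewrite mxE enum_rankK.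
  by move->; rewrite scale0r.
have := congr1 (form^~ (nth 0 ys i)) hsum; rewrite /= (form0l _ hf) (form_suml _ _ _ hf).
rewrite (bigD1 i) //= big1 ?addr0 => [|j ji]; last first.
  by rewrite (formZl _ _ _ hf) (ortho_frame_nth hf hys _ _).2 ?mulr0.
rewrite (formZl _ _ _ hf) => /eqP; rewrite mulf_eq0 => /orP[/eqP//|/eqP].
by move/(ortho_frame_nth hf hys (ltn_ord i) (ltn_ord i)); rewrite eqxx.
Qed.

(** The projection of P is built by the Gram-Schmidt recursion; that it lies in
    the span of the frame is recorded as membership in the double orthogonal. *)
Lemma ortho_frame_projection Z Y form ys P : hermitian_on Z form ->
  subspace Z -> subspace Y -> (forall y, Y y -> Z y) -> Z P ->
  ortho_frame Y form ys ->
  exists P1, [/\ Y P1, forall z, z \in ys -> form (P - P1) z = 0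
    & forall z, Z z -> (forall y, y \in ys -> form z y = 0) -> form z P1 = 0].
Proof.
move=> hf sZ sY YZ ZP; have [_ hc hd] := hf.
elim: ys => [|y ys IHys] /=.
  move=> _; exists 0; split=> // [|z Zz _]; first exact: sY.1.
  by apply: (form_eq0C hf) => //; [exact: sZ.1 | exact: (form0l _ hf)].
case=> Yy y0 hy hys; have [P1 [YP1 h1 h2]] := IHys hys.
have Zy := YZ _ Yy; have ZP1 := YZ _ YP1.
have nyy : form y y != 0 by apply/eqP => /(hd _ Zy).
set c := form P y / form y y.
have hP1y : form P1 y = 0 by apply: (form_eq0C hf) => //; apply: h2.
exists (c *: y + P1); split.
- exact: sY.2.
- move=> z; rewrite inE => /orP[/eqP->|hz].
    rewrite (formBl _ _ _ hf) (formDl _ _ _ hf) (formZl _ _ _ hf) hP1y addr0.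
    by rewrite divfK // subrr.
  rewrite opprD addrCA (formDl _ _ _ hf) h1 // addr0 -scaleNr (formZl _ _ _ hf).
  by rewrite hy // mulr0.
- move=> z Zz hz; rewrite (formDr sZ hf) //; last exact: subspaceZ.
  rewrite (formZr _ sZ hf) // hz ?mem_head // mulr0 add0r; apply: h2 => // w hw.
  by apply: hz; rewrite inE hw orbT.
Qed.

(** An orthogonal frame in Y of maximal length spans Y: otherwise the difference
    between a vector and its projection would extend it. *)
Lemma ortho_projection Z Y form P : hermitian_on Z form ->
  subspace Z -> finite_span Z -> subspace Y -> (forall y, Y y -> Z y) -> Z P ->
  exists2 P1, Y P1 & forall y, Y y -> form (P - P1) y = 0.
Proof.
move=> hf sZ [T [b hb]] sY YZ ZP.
have hfY : hermitian_on Y form.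
  case: hf => hl hc hd; split=> //; first by move=> *; apply: hc; apply: YZ.
  by move=> *; apply: hd => //; apply: YZ.
have fY : finite_span Y by exists T, b => Q /YZ; apply: hb.
have [N hN] := ortho_frame_size hfY sY fY.
pose good n := `[< exists2 ys, ortho_frame Y form ys & size ys = n >].
have ex0 : exists n, good n by exists 0%N; apply/asboolP; exists [::].
have leN n : good n -> (n <= N)%N by move=> /asboolP[ys hys <-]; apply: hN.
have [n /asboolP[ys hys hn] maxn] := ex_maxnP ex0 leN.
have [P1 [YP1 h1 h2]] := ortho_frame_projection hf sZ sY YZ ZP hys.
exists P1 => // y Yy.
have [y1 [Yy1 h3 h4]] := ortho_frame_projection hf sZ sY YZ (YZ _ Yy) hys.
have ey : y = y1.
  apply/eqP; rewrite -subr_eq0; apply/eqP; apply: contrapT => ny.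
  have : good n.+1.
    apply/asboolP; exists (y - y1 :: ys); last by rewrite /= hn.
    by split=> //; apply: subspaceB.
  by move/maxn; rewrite ltnn.
by rewrite ey; apply: h4 => //; apply: subspaceB => //; apply: YZ.
Qed.

End Subspaces.

(** * Polynomial functions of a matrix *)

Section PolynomialFunctions.
Variables (R : realType) (p q : nat).
Local Notation C := (Cplx R).
Local Notation mat := 'M[C]_(p, q).
Implicit Types (D : pred 'M[nat]_(p, q)) (P Q : mat -> C^o) (e w : 'M[nat]_(p, q)).

Lemma monomialD e e' (F : mat) :
  monomial (e + e') F = monomial e F * monomial e' F.
Proof.
rewrite /monomial -big_split; apply: eq_bigr => i _.
by rewrite -big_split; apply: eq_bigr => j _; rewrite mxE exprD.
Qed.

Lemma monomial0 (F : mat) : monomial 0 F = 1.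
Proof. by rewrite /monomial big1 // => i _; rewrite big1 // => j _; rewrite mxE. Qed.

Lemma monomial_delta i j (F : mat) : monomial (delta_mx i j) F = F i j.
Proof.
rewrite /monomial (bigD1 i) //= (bigD1 j) //= mxE !eqxx expr1 big1 ?mulr1; last first.
  by move=> j' /negbTE nj; rewrite mxE nj andbF.
by rewrite big1 ?mulr1 // => i' /negbTE ni; rewrite big1 // => j' _; rewrite mxE ni.
Qed.

Lemma polynomial_in_monomial D e : D e -> polynomial_in D (@monomial R p q e).
Proof.
move=> De; exists [:: (1, e)]; first by rewrite /= De.
by move=> A; rewrite big_seq1 mul1r.
Qed.

Lemma polynomial_in_subspace D :
  subspace (polynomial_in D : (mat -> C^o) -> Prop).
Proof.
split; first by exists [::] => // A; rewrite big_nil.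
move=> a P Q [s hs eP] [s' hs' eQ].
exists ([seq (a * t.1, t.2) | t <- s] ++ s').
  by rewrite all_cat hs' andbT all_map.
move=> A; rewrite big_cat big_map /=.
rewrite -eQ -[(a *: P + Q) A]/(a * P A + Q A) eP mulr_sumr.
by congr (_ + _); apply: eq_bigr => t _; rewrite mulrA.
Qed.

Lemma polynomial_in_sum D (I : Type) (s : seq I) (f : I -> mat -> C) :
  (forall i, polynomial_in D (f i)) ->
  polynomial_in D (fun F => \sum_(i <- s) f i F).
Proof.
move=> hf; have := subspace_sum (W := mat -> C^o) s (polynomial_in_subspace D)
  (fun i (_ : xpredT i) => hf i).
by rewrite fct_sumE.
Qed.

Lemma polynomial_inD D P Q : polynomial_in D P -> polynomial_in D Q ->
  polynomial_in D (fun F => P F + Q F).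
Proof. exact: (subspaceD (W := mat -> C^o) (polynomial_in_subspace D)). Qed.

Lemma polynomial_inZ D a P : polynomial_in D P ->
  polynomial_in D (fun F => a * P F).
Proof. exact: (subspaceZ (W := mat -> C^o) a (polynomial_in_subspace D)). Qed.

Lemma polynomial_inB D P Q : polynomial_in D P -> polynomial_in D Q ->
  polynomial_in D (fun F => P F - Q F).
Proof. exact: (subspaceB (W := mat -> C^o) (polynomial_in_subspace D)). Qed.

Lemma polynomial_in0 D : polynomial_in D (fun _ : mat => 0).
Proof. exact: (polynomial_in_subspace D).1. Qed.

Lemma sub_polynomial_in D D' P : {subset D <= D'} ->
  polynomial_in D P -> polynomial_in D' P.
Proof. by move=> sD [s hs eP]; exists s => //; apply: sub_all hs => t; apply: sD. Qed.

Lemma polynomial_in_cst D c : D 0 -> polynomial_in D (fun _ : mat => c).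
Proof.
move=> D0; exists [:: (c, 0)]; first by rewrite /= D0.
by move=> A; rewrite big_seq1 monomial0 mulr1.
Qed.

Lemma polynomial_in_entry D i j : D (delta_mx i j) ->
  polynomial_in D (fun F : mat => F i j).
Proof.
move=> hD; have := polynomial_in_monomial hD.
by congr (polynomial_in _ _); apply/funext => F; rewrite monomial_delta.
Qed.

Lemma polynomial_inM D D' D'' P Q :
  (forall e e', D e -> D' e' -> D'' (e + e')) ->
  polynomial_in D P -> polynomial_in D' Q ->
  polynomial_in D'' (fun F => P F * Q F).
Proof.
move=> hD [s hs eP] [s' hs' eQ].
exists [seq (t.1 * t'.1, t.2 + t'.2) | t <- s, t' <- s'].
  apply/allP => _ /allpairsP[[t t'] /= [ht ht' ->]] /=.
  by apply: hD; [apply: (allP hs) | apply: (allP hs')].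
move=> A; rewrite big_allpairs_dep eP eQ big_distrlr /=.
by apply: eq_bigr => t _; apply: eq_bigr => t' _; rewrite monomialD; ring.
Qed.

(** A family of exponent sets compatible with addition, such as the exponents
    of bounded degree: the corresponding polynomials form a filtered algebra. *)
Section Filtered.
Variables (L : nmodType) (D : L -> pred 'M[nat]_(p, q)).
Hypotheses (D0 : D 0 0)
  (DD : forall l l' e e', D l e -> D l' e' -> D (l + l') (e + e')).

Lemma filtered_exp l P n : polynomial_in (D l) P ->
  polynomial_in (D (l *+ n)) (fun F => P F ^+ n).
Proof.
move=> hP; elim: n => [|n IHn].
  by rewrite mulr0n; apply: polynomial_in_cst.
rewrite mulrS; under eq_fun => F do rewrite exprS.
exact: (polynomial_inM (DD (l := l) (l' := l *+ n))).
Qed.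

Lemma filtered_prod (I : Type) (s : seq I) (l : I -> L) (f : I -> mat -> C) :
  (forall i, polynomial_in (D (l i)) (f i)) ->
  polynomial_in (D (\sum_(i <- s) l i)) (fun F => \prod_(i <- s) f i F).
Proof.
move=> hf; elim: s => [|i s IHs].
  by rewrite big_nil; under eq_fun do rewrite big_nil; apply: polynomial_in_cst.
rewrite big_cons; under [X in polynomial_in _ X]eq_fun do rewrite big_cons.
exact: (polynomial_inM (DD (l := l i) (l' := \sum_(i <- s) l i))).
Qed.

End Filtered.

Lemma polynomial_funM P Q : polynomial_fun P -> polynomial_fun Q ->
  polynomial_fun (fun F => P F * Q F).
Proof. exact: polynomial_inM. Qed.

Lemma polynomial_funX P n : polynomial_fun P -> polynomial_fun (fun F => P F ^+ n).
Proof. exact: (filtered_exp (L := nat) (D := fun _ => xpredT)). Qed.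

Lemma polynomial_fun_prod (I : Type) (s : seq I) (f : I -> mat -> C) :
  (forall i, polynomial_fun (f i)) ->
  polynomial_fun (fun F => \prod_(i <- s) f i F).
Proof.
move=> hf.
exact: (@filtered_prod nat (fun _ => xpredT) _ _ I s (fun _ => 0%N) f hf).
Qed.

Lemma polynomial_fun_entry i j : polynomial_fun (fun F : mat => F i j).
Proof. exact: polynomial_in_entry. Qed.

Lemma polynomial_fun_in D P : polynomial_in D P -> polynomial_fun P.
Proof. exact: sub_polynomial_in. Qed.

Lemma polynomial_fun_curve P (G : 'M[{poly C}]_(p, q)) : polynomial_fun P ->
  exists r : {poly C}, forall t, r.[t] = P (map_mx (horner^~ t) G).
Proof.
case=> s _ eP.
exists (\sum_(u <- s) u.1%:P * \prod_(i < p) \prod_(j < q) G i j ^+ u.2 i j) => t.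
rewrite eP horner_sum; apply: eq_bigr => u _.
rewrite hornerM hornerC /monomial horner_prod; congr (_ * _).
apply: eq_bigr => i _; rewrite horner_prod; apply: eq_bigr => j _.
by rewrite horner_exp mxE.
Qed.

Lemma poly_eq0_nz (r : {poly C}) : (forall t, t != 0 -> r.[t] = 0) -> r = 0.
Proof.
move=> hr; apply/eqP; apply: contraT => r0.
pose s := [seq (n.+1%:R : C) | n <- iota 0 (size r)].
have := @max_poly_roots _ r s r0; rewrite size_map size_iota ltnn.
apply; first by apply/allP => _ /mapP[n _ ->]; apply/eqP/hr; rewrite pnatr_eq0.
rewrite map_inj_uniq ?iota_uniq // => n n' /eqP.
by rewrite eqr_nat eqSS => /eqP.
Qed.

Lemma poly_eq_nz (r r' : {poly C}) :
  (forall t, t != 0 -> r.[t] = r'.[t]) -> r = r'.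
Proof.
move=> hr; apply/eqP; rewrite -subr_eq0; apply/eqP/poly_eq0_nz => t t0.
by rewrite hornerD hornerN hr // subrr.
Qed.

(** Polynomial functions form an integral domain: restrict the product to the
    line through F and a point where the second factor does not vanish. *)
Lemma polynomial_fun_eq0 P Q (S : mat) : polynomial_fun P -> polynomial_fun Q ->
  Q S != 0 -> (forall F, Q F != 0 -> P F = 0) -> P = 0.
Proof.
move=> hP hQ QS hPQ; apply/funext => F.
pose G : 'M[{poly C}]_(p, q) := \matrix_(i, j) ((S i j)%:P + 'X * (F i j - S i j)%:P).
have hG t : map_mx (horner^~ t) G = S + t *: (F - S).
  by apply/matrixP => i j; rewrite !mxE !hornerE.
have [r hr] := polynomial_fun_curve G hP.
have [r' hr'] := polynomial_fun_curve G hQ.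
have : r * r' = 0.
  apply: poly_eq0_nz => t _; rewrite hornerM hr hr'.
  have [->|/hPQ ->] := eqVneq (Q (map_mx (horner^~ t) G)) 0.
    by rewrite mulr0.
  by rewrite mul0r.
move/eqP; rewrite mulf_eq0 => /orP[/eqP r0|/eqP r0].
  have := hr 1; rewrite r0 horner0 hG scale1r addrC subrK => <-.
  by [].
have := hr' 0; rewrite r0 horner0 hG scale0r addr0 => /esym/eqP.
by rewrite (negbTE QS).
Qed.

Definition scale_entries w (t : C) (F : mat) : mat :=
  \matrix_(i, j) (t ^+ w i j * F i j).

Definition weight w e : nat := (\sum_i \sum_j w i j * e i j)%N.

Lemma monomial_scale w e t F :
  monomial e (scale_entries w t F) = t ^+ weight w e * monomial e F.
Proof.
rewrite /monomial /weight expr_sum -big_split; apply: eq_bigr => i _.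
rewrite expr_sum -big_split; apply: eq_bigr => j _.
by rewrite mxE exprMn exprM.
Qed.

Lemma weight_components D P w N : polynomial_in D P ->
  (forall e, D e -> (weight w e <= N)%N) ->
  exists Pk : nat -> mat -> C^o,
    (forall k, polynomial_in (fun e => D e && (weight w e == k)) (Pk k)) /\
    forall t F, P (scale_entries w t F) = \sum_(k < N.+1) t ^+ k * Pk k F.
Proof.
case=> s hs eP hN.
exists (fun k F => \sum_(u <- s | weight w u.2 == k) u.1 * monomial u.2 F).
split=> [k|t F].
  exists [seq u <- s | weight w u.2 == k].
    rewrite all_filter; apply: sub_all hs => u Du /=.
    by apply/implyP => ->; rewrite Du.
  by move=> A; rewrite big_filter.
rewrite eP; under [RHS]eq_bigr => k _ do rewrite mulr_sumr big_mkcond /=.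
rewrite exchange_big /= big_seq_cond [RHS]big_seq_cond.
apply: eq_bigr => u /andP[us _].
have hu : (weight w u.2 < N.+1)%N by rewrite ltnS; apply: hN; apply: (allP hs).
rewrite monomial_scale (bigD1 (Ordinal hu)) //= eqxx big1 ?addr0; first by ring.
by move=> k; rewrite -val_eqE /= eq_sym => /negbTE ->.
Qed.

Lemma polynomial_fun_bounded D P w : polynomial_in D P ->
  exists N, polynomial_in (fun e => D e && (weight w e <= N)%N) P.
Proof.
case=> s hs eP; exists (\max_(u <- s) weight w u.2)%N; exists s => //.
apply/allP => u us; rewrite (allP hs _ us) /=.
by rewrite (big_rem u) //= leq_maxl.
Qed.

(** For fixed F, both sides of the hypothesis are polynomials in t; the
    coefficient of t^k on the left only involves the monomials of weight k. *)
Lemma polynomial_in_weight D P w k : polynomial_in D P ->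
  (forall t F, t != 0 -> P (scale_entries w t F) = t ^+ k * P F) ->
  polynomial_in (fun e => D e && (weight w e == k)) P.
Proof.
move=> /(polynomial_fun_bounded w)[N hP] hom.
have [|Pk [hPk ePk]] := weight_components hP (w := w) (N := N).
  by move=> e /andP[].
have ecoef F : \sum_(j < N.+1) (Pk j F)%:P * 'X^j = (P F)%:P * 'X^k.
  apply: poly_eq_nz => t t0; rewrite horner_sum !hornerE [P F * _]mulrC -hom // ePk.
  by apply: eq_bigr => j _; rewrite !hornerE mulrC.
have [ltk|lek] := ltnP k N.+1.
  have -> : P = Pk k.
    apply/funext => F; have := congr1 (fun r : {poly C} => r`_k) (ecoef F).
    rewrite coefCM coefXn eqxx mulr1 => <-.
    rewrite coef_sum (bigD1 (Ordinal ltk)) //= coefCM coefXn eqxx mulr1.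
    rewrite big1 ?addr0 // => j; rewrite -val_eqE /= eq_sym => /negbTE nj.
    by rewrite coefCM coefXn nj mulr0.
  by apply: sub_polynomial_in (hPk k) => e /andP[/andP[? _] ?]; apply/andP.
have -> : P = fun _ => 0.
  apply/funext => F; have := congr1 (fun r : {poly C} => r`_k) (ecoef F).
  rewrite coefCM coefXn eqxx mulr1 => <-; rewrite coef_sum big1 // => j _.
  by rewrite coefCM coefXn gtn_eqF ?mulr0 // (leq_trans (ltn_ord j)).
exact: polynomial_in0.
Qed.

End PolynomialFunctions.

(** * An invariant inner product on polynomials *)

Section ReproducingKernel.
Variables (R : realType) (p q : nat).
Local Notation C := (Cplx R).
Local Notation mat := 'M[C]_(p, q).
Variable d : nat.
Implicit Types (P Q : mat -> C^o) (F G : mat).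

Definition bounded_degree : (mat -> C^o) -> Prop :=
  polynomial_in (fun e => (weight (const_mx 1%N) e <= d)%N).

Lemma bounded_degree_subspace : subspace bounded_degree.
Proof. exact: polynomial_in_subspace. Qed.

(** The coordinates of F completed by the constant 1, so that products of d of
    them are the monomials of degree at most d. *)
Definition affine_coord (o : option ('I_p * 'I_q)) F : C :=
  if o is Some ij then F ij.1 ij.2 else 1.

Local Notation word := {ffun 'I_d -> option ('I_p * 'I_q)}.

Definition word_monomial (f : word) F : C := \prod_k affine_coord (f k) F.

(** The expansion of this kernel in monomials has positive coefficients, so it is
    the reproducing kernel of an inner product on the polynomials of degree at most
    d. Translating F amounts to translating G by the adjoint matrix. *)
Definition kernel G F : C :=
  (\sum_o affine_coord o F * (affine_coord o G)^*) ^+ d.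

Lemma kernelE G F :
  kernel G F = \sum_(f : word) word_monomial f F * (word_monomial f G)^*.
Proof.
rewrite /kernel -[in LHS](card_ord d) -prodr_const bigA_distr_bigA /=.
by apply: eq_bigr => f _; rewrite big_split /= rmorph_prod.
Qed.

Lemma kernelC G F : kernel G F = (kernel F G)^*.
Proof.
rewrite !kernelE rmorph_sum; apply: eq_bigr => f _.
by rewrite rmorphM /= conjCK mulrC.
Qed.

Lemma monomial_word e : (weight (const_mx 1%N) e <= d)%N ->
  exists f : word, forall F, monomial e F = word_monomial f F.
Proof.
move=> led.
pose l := flatten [seq nseq (e ij.1 ij.2) ij | ij <- enum {: 'I_p * 'I_q}].
have hl F : monomial e F = \prod_(ij <- l) F ij.1 ij.2.
  rewrite big_flatten big_map /monomial /= big_enum /=.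
  rewrite (pair_bigA _ (fun i j => F i j ^+ e i j)) /=.
  by apply: eq_bigr => ij _; rewrite big_nseq -Monoid.iteropE.
have sl : (size l <= d)%N.
  apply: leq_trans led; rewrite size_flatten /shape -map_comp sumnE big_map.
  rewrite big_enum /= /weight.
  rewrite (pair_bigA _ (fun i j => const_mx 1%N i j * e i j))%N /=.
  by apply: leq_sum => ij _; rewrite /= size_nseq mxE mul1n.
exists [ffun k => nth None (map Some l) (k : 'I_d)] => F.
rewrite hl /word_monomial.
under [RHS]eq_bigr do rewrite ffunE.
rewrite -(big_mkord xpredT (fun k => affine_coord (nth None (map Some l) k) F)).
rewrite (big_cat_nat (n := size l)) //= [X in _ * X]big_nat_cond [X in _ * X]big1 ?mulr1.
  rewrite -(size_map Some l) -(big_nth None xpredT (affine_coord^~ F)).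
  by rewrite big_map.
by move=> k /andP[/andP[lek _] _]; rewrite nth_default // size_map.
Qed.

Lemma bounded_degree_words P : bounded_degree P ->
  exists c : word -> C, P = \sum_f c f *: (word_monomial f : mat -> C^o).
Proof.
case=> s hs eP.
have -> : P = \sum_(u <- s) u.1 *: (@monomial R p q u.2 : mat -> C^o).
  by rewrite fct_sumE; apply/funext => F; rewrite eP.
elim: s hs {eP} => [_|u s IHs /= /andP[hu /IHs[c ec]]].
  by exists (fun _ => 0); rewrite big_nil big1 // => f _; rewrite scale0r.
have [g /funext hg] := monomial_word hu.
exists (fun f => (if f == g then u.1 else 0) + c f); rewrite big_cons ec.
under [RHS]eq_bigr do rewrite scalerDl.
rewrite big_split /=; congr (_ + _); rewrite (bigD1 g) //= eqxx hg big1 ?addr0 //.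
by move=> f /negbTE ->; rewrite scale0r.
Qed.

Lemma bounded_degree_finite_span : finite_span bounded_degree.
Proof.
exists word, (fun f => (word_monomial f : mat -> C^o)) => P.
exact: bounded_degree_words.
Qed.

Definition kernel_sum (s : seq (C * mat)) F : C :=
  \sum_(u <- s) u.1 * kernel u.2 F.

(** The coefficients of P can be projected on the span of the vectors
    (conj (word_monomial f G))_f, since the orthogonal of these vectors consists
    of the relations between the functions word_monomial f. *)
Lemma bounded_degree_kernel_sum P : bounded_degree P ->
  exists s, P = kernel_sum s.
Proof.
case/bounded_degree_words => c eP.
pose form (a b : word -> C^o) : C := \sum_f a f * (b f)^*.
have hf : hermitian_on (fun _ => True) form.
  split=> [a u u' v|u v _ _|u _].
  - rewrite /form mulr_sumr -big_split; apply: eq_bigr => f _ /=.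
    by rewrite -[(a *: u + u') f]/(a * u f + u' f); ring.
  - rewrite /form rmorph_sum; apply: eq_bigr => f _.
    by rewrite rmorphM /= conjCK mulrC.
  - move=> uu; apply/funext => f; apply/eqP; rewrite -normr_eq0.
    have : `|u f| ^+ 2 = 0.
      apply: (psumr_eq0P (P := xpredT) (F := fun f => `|u f| ^+ 2)) => // [g _|].
        by rewrite exprn_ge0.
      by rewrite -[RHS]uu; apply: eq_bigr => g _; rewrite normCK.
    by move/eqP; rewrite expf_eq0.
have sT : subspace (fun _ : word -> C^o => True) by [].
have fT : finite_span (fun _ : word -> C^o => True).
  exists word, (fun f g => (f == g)%:R) => u _; exists u.
  rewrite fct_sumE; apply/funext => f.
  rewrite (bigD1 f) //= big1 => [|g /negbTE gf].
    by rewrite addr0 -[LHS]mulr1 -[RHS]/(u f * (f == f)%:R) eqxx.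
  by rewrite -[LHS]/(u g * (g == f)%:R) gf mulr0.
pose Y (u : word -> C^o) := exists s : seq (C * mat),
  u = fun f => \sum_(t <- s) t.1 * (word_monomial f t.2)^*.
have sY : subspace Y.
  split; first by exists [::]; apply/funext => f; rewrite big_nil.
  move=> a _ _ [s ->] [s' ->].
  exists ([seq (a * t.1, t.2) | t <- s] ++ s'); apply/funext => f.
  rewrite big_cat big_map /=; congr (_ + _).
  by rewrite -[LHS]/(a * _) mulr_sumr; apply: eq_bigr => t _; rewrite mulrA.
have [u [s eu] hu] := 
  ortho_projection (P := c : word -> C^o) hf sT fT sY (fun _ _ => I) I.
exists s; apply/funext => G.
have /hu : Y (fun f => (word_monomial f G)^*).
  by exists [:: (1, G)]; apply/funext => f; rewrite big_seq1 mul1r.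
rewrite (formBl _ _ _ hf) /form => /eqP; rewrite subr_eq0 => /eqP h.
have -> : P G = \sum_f c f * word_monomial f G.
  by rewrite eP fct_sumE.
transitivity (\sum_f u f * word_monomial f G).
  by transitivity (\sum_f c f * (word_monomial f G)^*^*);
    [|rewrite h]; apply: eq_bigr => f _; rewrite conjCK.
rewrite eu /kernel_sum; under [RHS]eq_bigr => t _ do rewrite kernelE mulr_sumr.
rewrite exchange_big /=; apply: eq_bigr => f _; rewrite mulr_suml.
by apply: eq_bigr => t _; ring.
Qed.

(** The inner product for which kernel reproduces the values: Q is a
    combination of the kernel functions at points G_u with coefficients a_u,
    and the product of P by Q is the sum of the conj (a_u) * P G_u. *)
Definition kernel_form P Q : C :=
  \sum_(u <- xget [::] [set s | Q = kernel_sum s]) u.1^* * P u.2.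

Lemma kernel_formE P Q s : bounded_degree P -> Q = kernel_sum s ->
  kernel_form P Q = \sum_(u <- s) u.1^* * P u.2.
Proof.
move=> hP hs; have [s' hs'] := bounded_degree_kernel_sum hP.
suff H s1 : Q = kernel_sum s1 ->
    \sum_(u <- s1) u.1^* * P u.2 = \sum_(v <- s') v.1 * (Q v.2)^*.
  rewrite (H s) // /kernel_form H //.
  exact: (xgetPex [::] (P := [set s1 | Q = kernel_sum s1]) (ex_intro _ s hs)).
move=> ->; rewrite hs' /kernel_sum.
under eq_bigr => u _ do rewrite mulr_sumr.
rewrite exchange_big /=; apply: eq_bigr => v _.
rewrite rmorph_sum mulr_sumr; apply: eq_bigr => u _.
by rewrite rmorphM /= -kernelC; ring.
Qed.

Lemma kernel_form_hermitian : hermitian_on bounded_degree kernel_form.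
Proof.
split=> [a P P' Q|P Q hP hQ|P hP].
- rewrite /kernel_form mulr_sumr -big_split; apply: eq_bigr => u _ /=.
  by rewrite -[(a *: P + P') u.2]/(a * P u.2 + P' u.2); ring.
- have [s hs] := bounded_degree_kernel_sum hP.
  have [s' hs'] := bounded_degree_kernel_sum hQ.
  rewrite (kernel_formE hP hs') (kernel_formE hQ hs) hs hs' /kernel_sum.
  rewrite rmorph_sum; under eq_bigr => u _ do rewrite mulr_sumr.
  under [RHS]eq_bigr => u _ do rewrite mulr_sumr rmorph_sum.
  rewrite exchange_big /=; apply: eq_bigr => u _; apply: eq_bigr => v _.
  by rewrite !rmorphM /= conjCK -kernelC; ring.
- have [s hs] := bounded_degree_kernel_sum hP; rewrite (kernel_formE hP hs).
  pose a f := \sum_(u <- s) u.1 * (word_monomial f u.2)^*.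
  have eP F : P F = \sum_f a f * word_monomial f F.
    rewrite hs /kernel_sum; under eq_bigr => u _ do rewrite kernelE mulr_sumr.
    rewrite exchange_big /=; apply: eq_bigr => f _; rewrite mulr_suml.
    by apply: eq_bigr => u _; ring.
  move=> h0; have ha f : a f = 0.
    apply/eqP; rewrite -normr_eq0.
    have : `|a f| ^+ 2 = 0.
      apply: (psumr_eq0P (P := xpredT) (F := fun f => `|a f| ^+ 2)) => // [g _|].
        by rewrite exprn_ge0.
      rewrite -[RHS]h0; under [RHS]eq_bigr => u _ do rewrite eP mulr_sumr.
      rewrite exchange_big /=; apply: eq_bigr => g _; rewrite normCK.
      rewrite [in X in _ * X]/a rmorph_sum mulr_sumr; apply: eq_bigr => u _.
      by rewrite rmorphM /= conjCK; ring.
    by move/eqP; rewrite expf_eq0.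
  by apply/funext => F; rewrite eP big1 // => f _; rewrite ha mul0r.
Qed.

(** The kernel functions span, and the product with the one at G is the value at
    G, so it is enough that phi and phi' exchange these functions. *)
Lemma kernel_form_adjoint (phi phi' : mat -> mat) P Q :
  (forall F G, kernel G (phi' F) = kernel (phi G) F) ->
  bounded_degree P -> bounded_degree (P \o phi) -> bounded_degree Q ->
  kernel_form (P \o phi) Q = kernel_form P (Q \o phi').
Proof.
move=> hk hP hPphi hQ; have [s hs] := bounded_degree_kernel_sum hQ.
rewrite (kernel_formE hPphi hs).
rewrite (@kernel_formE P _ [seq (u.1, phi u.2) | u <- s]) //.
  by rewrite big_map.
apply/funext => F; rewrite /= hs /kernel_sum big_map.
by apply: eq_bigr => u _; rewrite hk.
Qed.

Lemma kernel_trace G F :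
  kernel G F = (1 + \sum_i \sum_j F i j * (G i j)^*) ^+ d.
Proof.
rewrite /kernel; congr (_ ^+ d).
rewrite (bigD1 None) //= conjC1 mulr1; congr (_ + _).
rewrite (pair_bigA _ (fun i j => F i j * (G i j)^*)) /=.
rewrite (reindex_omap Some id) /=; last by case.
by apply: eq_big => ij; rewrite ?eqxx.
Qed.

End ReproducingKernel.

Definition adjmx (R : realType) (n : nat) (A : 'M[Cplx R]_n) : 'M[Cplx R]_n :=
  map_mx (fun z => z^*) A^T.

Section Adjoint.
Variables (R : realType) (p q d : nat).
Local Notation C := (Cplx R).
Local Notation mat := 'M[C]_(p, q).
Implicit Types (P Q : mat -> C^o).

Lemma kernel_form_right (A : 'M[C]_q) P Q :
  bounded_degree d P -> bounded_degree d (fun F => P (F *m A)) ->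
  bounded_degree d Q ->
  kernel_form d (fun F => P (F *m A)) Q
  = kernel_form d P (fun F => Q (F *m adjmx A)).
Proof.
apply: (@kernel_form_adjoint _ _ _ _ (mulmxr A) (mulmxr (adjmx A))) => F G.
rewrite !kernel_trace; congr ((_ + _) ^+ _); apply: eq_bigr => i _ /=.
under eq_bigr => j _ do rewrite mxE mulr_suml.
rewrite exchange_big /=; apply: eq_bigr => k _; rewrite mxE rmorph_sum mulr_sumr.
by apply: eq_bigr => j _; rewrite !mxE rmorphM; ring.
Qed.

Lemma kernel_form_left (A : 'M[C]_p) P Q :
  bounded_degree d P -> bounded_degree d (fun F => P (A *m F)) ->
  bounded_degree d Q ->
  kernel_form d (fun F => P (A *m F)) Q
  = kernel_form d P (fun F => Q (adjmx A *m F)).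
Proof.
apply: (@kernel_form_adjoint _ _ _ _ (mulmx A) (mulmx (adjmx A))) => F G.
rewrite !kernel_trace; congr ((_ + _) ^+ _).
rewrite exchange_big [RHS]exchange_big /=; apply: eq_bigr => j _.
under eq_bigr => i _ do rewrite mxE mulr_suml.
rewrite exchange_big /=; apply: eq_bigr => k _; rewrite mxE rmorph_sum mulr_sumr.
by apply: eq_bigr => i _; rewrite !mxE rmorphM; ring.
Qed.

End Adjoint.

(** * Highest weight vectors *)

Section HighestWeights.
Variables (R : realType) (p n : nat).
Local Notation C := (Cplx R).
Local Notation mat := 'M[C]_(p, n).
Implicit Types (P Q : mat -> C^o) (F : mat) (Y : (mat -> C^o) -> Prop).

Definition character (l : 'I_n -> nat) (B : 'M[C]_n) : C :=
  \prod_k B k k ^+ l k.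

Definition semi_invariant (l : 'I_n -> nat) P : Prop :=
  forall B : 'M[C]_n, B \in unitmx -> is_trig_mx B^T ->
    forall F, P (F *m B) = character l B * P F.

Definition right_stable Y : Prop :=
  forall (A : 'M[C]_n) P, A \in unitmx -> Y P -> Y (fun F => P (F *m A)).

Definition torus (w : 'I_n -> nat) (t : C) : 'M[C]_n :=
  diag_mx (\row_j t ^+ w j).

Lemma torus_unit w t : t != 0 -> torus w t \in unitmx.
Proof.
move=> t0; rewrite unitmxE det_diag unitfE prodf_seq_neq0.
by apply/allP => j _; rewrite mxE /= expf_neq0.
Qed.

Lemma mul_torus w t F :
  F *m torus w t = scale_entries (\matrix_(i, j) w j) t F.
Proof. by apply/matrixP => i j; rewrite mul_mx_diag !mxE mulrC. Qed.

Definition weight_vector w k P : Prop :=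
  forall t F, t != 0 -> P (F *m torus w t) = t ^+ k * P F.

Definition torus_stable w Y : Prop :=
  forall t P, t != 0 -> Y P -> Y (fun F => P (F *m torus w t)).

Variable d : nat.
Local Notation bounded := (@bounded_degree R p n d).
Local Notation top w := (d * \max_j w j)%N.

Lemma torus_weight_le (w : 'I_n -> nat) (e : 'M[nat]_(p, n)) :
  (weight (const_mx 1%N) e <= d)%N ->
  (weight (\matrix_(i, j) w j) e <= top w)%N.
Proof.
move=> led; apply: (@leq_trans (weight (const_mx 1%N) e * \max_j w j)); last first.
  by rewrite leq_mul2r led orbT.
rewrite /weight big_distrl; apply: leq_sum => i _; rewrite big_distrl.
apply: leq_sum => j _; rewrite !mxE mul1n mulnC leq_mul2l.
by rewrite leq_bigmax orbT.
Qed.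

Lemma weight_vector_le w k P : bounded P -> weight_vector w k P -> P <> 0 ->
  (k <= top w)%N.
Proof.
move=> hP hk nz; rewrite leqNgt; apply/negP => ltk; apply: nz.
have [|s hs eP] := polynomial_in_weight (k := k) (w := \matrix_(i, j) w j) hP.
  by move=> t F t0; rewrite -mul_torus hk.
apply/funext => F; rewrite eP; case: s hs {eP} => [|u s /= /andP[+ _]].
  by rewrite big_nil.
by case/andP => /(torus_weight_le w) + /eqP eu; rewrite eu leqNgt ltk.
Qed.

Lemma torus_components w Y P : subspace Y -> (forall Q, Y Q -> bounded Q) ->
  torus_stable w Y -> Y P ->
  exists Pk : nat -> mat -> C^o,
    [/\ forall k, (k <= top w)%N -> Y (Pk k),
        forall k, weight_vector w k (Pk k)
      & forall t F, P (F *m torus w t) = \sum_(k < (top w).+1) t ^+ k * Pk k F].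
Proof.
move=> sY bY tY YP.
have [Pk [hPk ePk]] := weight_components (w := \matrix_(i, j) w j) (bY _ YP)
  (@torus_weight_le w).
exists Pk; split=> [k lek|k|t F]; last by rewrite mul_torus.
- apply: (subspace_coef (n := (top w).+1) sY) => // t t0.
  have := tY t P t0 YP; congr (Y _); apply/funext => F.
  by rewrite mul_torus ePk fct_sumE; apply: eq_bigr.
- move=> t F t0; have [s hs eP] := hPk k; rewrite mul_torus !eP mulr_sumr.
  rewrite big_seq [RHS]big_seq; apply: eq_bigr => u us.
  have /andP[_ /eqP <-] := allP hs _ us.
  by rewrite monomial_scale; ring.
Qed.

Lemma torus1 w : torus w 1 = 1%:M.
Proof.
by rewrite /torus -diag_const_mx; congr diag_mx; apply/rowP => j; rewrite !mxE expr1n.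
Qed.

Lemma weight_vector_exists w Y : subspace Y -> (forall Q, Y Q -> bounded Q) ->
  torus_stable w Y -> (exists2 P, Y P & P <> 0) ->
  exists k P, [/\ Y P, P <> 0 & weight_vector w k P].
Proof.
move=> sY bY tY [P YP nz]; have [Pk [YPk wPk ePk]] := torus_components sY bY tY YP.
apply: contrapT => none; apply: nz; apply/funext => F.
rewrite -[F]mulmx1 -(torus1 w) ePk big1 // => k _.
have -> : Pk k = 0; last by rewrite mulr0.
apply: contrapT => nz; apply: none; exists k, (Pk k); split=> //.
by apply: YPk; rewrite -ltnS.
Qed.

Definition unipotent_invariant P : Prop :=
  forall B : 'M[C]_n, B \in unitmx -> is_trig_mx B^T ->
    forall F, P (F *m B) = P (F *m diag_mx (\row_j B j j)).

(** A strictly decreasing one-parameter torus: conjugating an upper triangular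
    matrix by it multiplies the strictly upper entries by positive powers of t. *)
Definition coweight (j : 'I_n) : nat := rev_ord j.

(** If k is the highest weight of Y for the torus t |-> t^coweight, then for P of
    weight k and B upper triangular, P (F B_t) is a polynomial in t that takes
    the value P (F B) at 1 and P (F (diag B)) at 0; since translation by B only
    raises weights, this polynomial is constant. *)
Lemma unipotent_invariant_exists Y : subspace Y -> (forall Q, Y Q -> bounded Q) ->
  right_stable Y -> (exists2 P, Y P & P <> 0) ->
  exists P, [/\ Y P, P <> 0 & unipotent_invariant P].
Proof.
move=> sY bY rY nY.
have tY : torus_stable coweight Y.
  by move=> t P t0; apply: rY; apply: torus_unit.
pose good k := `[< exists P, [/\ Y P, P <> 0 & weight_vector coweight k P] >].
have ex0 : exists k, good k.
  have [k [P hP]] := weight_vector_exists sY bY tY nY.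
  by exists k; apply/asboolP; exists P.
have leN k : good k -> (k <= top coweight)%N.
  by move=> /asboolP[P [YP nz wP]]; apply: (weight_vector_le (bY _ YP) wP).
have [k /asboolP[P [YP nz wP]] maxk] := ex_maxnP ex0 leN.
exists P; split=> // B uB tB F.
have YQ : Y (fun F => P (F *m B)) by apply: rY.
have [Qk [YQk wQk eQk]] := torus_components sY bY tY YQ.
have Qk0 j : (j <= top coweight)%N -> (k < j)%N -> Qk j = 0.
  move=> lej ltj; apply: contrapT => nzj.
  have /maxk : good j by apply/asboolP; exists (Qk j); split=> //; apply: YQk.
  by rewrite leqNgt ltj.
have B0 (i j : 'I_n) : (j < i)%N -> B i j = 0.
  by move=> ltji; have /is_trig_mxP/(_ j i ltji) := tB; rewrite mxE.
pose Bt t : 'M[C]_n := \matrix_(i, j) (t ^+ (coweight i - coweight j) * B i j).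
pose G : 'M[{poly C}]_(p, n) :=
  \matrix_(i, j) \sum_a (F i a)%:P * ('X^(coweight a - coweight j) * (B a j)%:P).
have hG t : map_mx (horner^~ t) G = F *m Bt t.
  apply/matrixP => i j; rewrite !mxE horner_sum; apply: eq_bigr => a _.
  by rewrite !(hornerM, hornerC, hornerXn) mxE.
have [r hr] := polynomial_fun_curve G (polynomial_fun_in (bY _ YP)).
have le_cow (i j : 'I_n) : (i <= j)%N -> (coweight j <= coweight i)%N.
  by move=> leij; rewrite /coweight /=; apply: leq_sub2l; rewrite ltnS.
have commB t : t != 0 -> torus coweight t *m B = Bt t *m torus coweight t.
  move=> t0; apply/matrixP => i j; rewrite mul_mx_diag mul_diag_mx !mxE.
  have [leij|/B0 ->] := leqP i j; last by rewrite !(mulr0, mul0r).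
  by rewrite mulrAC -exprD subnK // le_cow.
have er : 'X^k * r = \sum_(j < (top coweight).+1) (Qk j F : C)%:P * 'X^j.
  apply: poly_eq_nz => t t0; rewrite horner_sum hornerM hornerXn hr hG -wP //.
  rewrite -mulmxA -commB // mulmxA eQk.
  by apply: eq_bigr => j _; rewrite !hornerE mulrC.
have sr : (size r <= 1)%N.
  have [->|r0] := eqVneq r 0; first by rewrite size_poly0.
  have : (size ('X^k * r)%R <= k.+1)%N.
    rewrite er; apply: (leq_trans (size_sum _ _ _)); apply/bigmax_leqP => j _.
    have [lejk|ltkj] := leqP j k; last first.
      have -> : (Qk j F : C) = 0 by rewrite Qk0 // -ltnS.
      by rewrite polyC0 mul0r size_poly0.
    by rewrite mul_polyC (leq_trans (size_scale_leq _ _)) // size_polyXn ltnS.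
  by rewrite mulrC size_mulXn // -addn1 leq_add2l.
have [c ec] : exists c, r = c%:P by exists r`_0; apply: size1_polyC.
have := hr 0; rewrite ec hornerC -(hornerC c 1) -[X in X.[1]]ec hr !hG.
have -> : Bt 1 = B by apply/matrixP => i j; rewrite mxE expr1n mul1r.
move->; congr (P (F *m _)); apply/matrixP => i j; rewrite !mxE.
have [ltij|ltji|/ord_inj ->] := ltngtP i j.
- rewrite -val_eqE ltn_eqF // expr0n subn_eq0 leqNgt.
  have -> : (coweight j < coweight i)%N.
    by rewrite /coweight /=; apply: ltn_sub2l => //; apply: leq_ltn_trans ltij _.
  by rewrite mul0r.
- by rewrite B0 // -val_eqE gtn_eqF // mulr0.
- by rewrite eqxx subnn mul1r.
Qed.

End HighestWeights.

Section HighestWeightVectors.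
Variables (R : realType) (p n d : nat).
Local Notation C := (Cplx R).
Local Notation mat := 'M[C]_(p, n).
Implicit Types (P Q : mat -> C^o) (F : mat) (Y : (mat -> C^o) -> Prop).

Lemma semi_invariant_subspace l :
  subspace (semi_invariant l : (mat -> C^o) -> Prop).
Proof.
split=> [B _ _ F|a P Q hP hQ B uB tB F]; first by rewrite -[RHS]/(_ * 0) mulr0.
have e G : (a *: P + Q) G = a * P G + Q G by [].
by rewrite !e hP // hQ //; ring.
Qed.

Lemma unipotent_invariant_subspace :
  subspace (@unipotent_invariant R p n : (mat -> C^o) -> Prop).
Proof.
split=> [B _ _ F //|a P Q hP hQ B uB tB F].
have e G : (a *: P + Q) G = a * P G + Q G by [].
by rewrite !e hP // hQ.
Qed.

Lemma weight_vector_subspace w k :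
  subspace (weight_vector w k : (mat -> C^o) -> Prop).
Proof.
split=> [t F _|a P Q hP hQ t F t0]; first by rewrite -[RHS]/(_ * 0) mulr0.
have e G : (a *: P + Q) G = a * P G + Q G by [].
by rewrite !e hP // hQ //; ring.
Qed.

Lemma torus_comm (w w' : 'I_n -> nat) (t s : C) :
  torus w t *m torus w' s = torus w' s *m torus w t.
Proof. exact: diag_mxC. Qed.

Lemma unipotent_invariant_torus w t P : t != 0 -> unipotent_invariant P ->
  unipotent_invariant (fun F => P (F *m torus w t)).
Proof.
move=> t0 hP B uB tB F.
have uT := torus_unit w t0.
have eBT i j : (B *m torus w t) i j = B i j * t ^+ w j.
  by rewrite mul_mx_diag !mxE.
have tBT : is_trig_mx (B *m torus w t)^T.
  apply/is_trig_mxP => i j ltij; rewrite mxE eBT.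
  by have /is_trig_mxP/(_ i j ltij) := tB; rewrite mxE => ->; rewrite mul0r.
rewrite -!mulmxA hP ?unitmx_mul ?uB //; congr (P (F *m _)).
have -> : \row_j (B *m torus w t) j j = \row_j (B j j * t ^+ w j).
  by apply/rowP => j; rewrite !mxE -eBT !mxE.
apply/matrixP => i j; rewrite mul_mx_diag !mxE mulrnAl.
by case: eqP => // ->.
Qed.

Lemma right_stable_torus w Y : right_stable Y -> torus_stable w Y.
Proof. by move=> rY t P t0; apply: rY; apply: torus_unit. Qed.

(** The torus acts on the unipotent invariants, where its coordinates can be
    diagonalised one after the other. *)
Lemma highest_weight_vector Y : subspace Y ->
  (forall P, Y P -> bounded_degree d P) -> right_stable Y ->
  (exists2 P, Y P & P <> 0) ->
  exists l P, [/\ Y P, P <> 0 & semi_invariant l P].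
Proof.
move=> sY bY rY nY.
have [P0 [YP0 nz0 uP0]] := unipotent_invariant_exists sY bY rY nY.
have step k : (k <= n)%N -> exists (l : 'I_n -> nat) P,
    [/\ Y P, P <> 0, unipotent_invariant P
      & forall j : 'I_n, (j < k)%N -> weight_vector (fun i => (i == j) : nat) (l j) P].
  elim: k => [_|k IHk ltkn]; first by exists (fun _ => 0%N), P0.
  have [l [P [YP nz uP wP]]] := IHk (ltnW ltkn).
  pose wt (j i : 'I_n) : nat := (i == j).
  pose Y' Q := (Y Q /\ unipotent_invariant Q) /\
    forall j : 'I_n, (j < k)%N -> weight_vector (wt j) (l j) Q.
  have sY' : subspace Y'.
    apply: subspaceI; first exact: (subspaceI sY unipotent_invariant_subspace).
    split=> [j _|a Q Q' hQ hQ' j ltj].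
      exact: (weight_vector_subspace _ _).1.
    by apply: (weight_vector_subspace _ _).2; [apply: hQ | apply: hQ'].
  have bY' Q : Y' Q -> bounded_degree d Q by case=> [[/bY]].
  have tY' : torus_stable (wt (Ordinal ltkn)) Y'.
    move=> t Q t0 [[YQ uQ] wQ]; split; first split.
    - exact: (right_stable_torus _ rY).
    - exact: unipotent_invariant_torus.
    - by move=> j ltj s F s0; rewrite -mulmxA torus_comm mulmxA wQ.
  have [|k' [Q [[[YQ uQ] wQ] nzQ wkQ]]] := weight_vector_exists sY' bY' tY'.
    by exists P.
  exists (fun j : 'I_n => if (j : nat) == k then k' else l j), Q.
  split=> // j.
  rewrite ltnS leq_eqVlt => /orP[/eqP ejk|ltjk].
    have -> : j = Ordinal ltkn by apply: val_inj.
    by rewrite eqxx.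
  by rewrite ltn_eqF //; apply: wQ.
have [l [P [YP nz uP wP]]] := step n (leqnn n).
exists l, P; split=> // B uB tB F; rewrite uP //.
have Bnz j : B j j != 0.
  move: uB; rewrite unitmxE -det_tr det_trig // unitfE prodf_seq_neq0.
  by move=> /allP/(_ j); rewrite mem_index_enum mxE; apply.
(* D k has the first k diagonal entries of B, and 1 after them. *)
pose D k : 'M[C]_n := diag_mx (\row_j if (j < k)%N then B j j else 1).
have hD k : (k <= n)%N ->
    P (F *m D k) = (\prod_(j < n | (j < k)%N) B j j ^+ l j) * P F.
  elim: k => [_|k IHk ltkn].
    rewrite big_pred0 // mul1r -[in RHS](mulmx1 F); congr (P (F *m _)).
    by rewrite /D -diag_const_mx; congr diag_mx; apply/rowP => j; rewrite !mxE.
  pose j0 := Ordinal ltkn.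
  have -> : D k.+1 = D k *m torus (fun i => (i == j0) : nat) (B j0 j0).
    apply/matrixP => i j; rewrite mul_mx_diag !mxE.
    have [<-|nij] := eqVneq i j; last by rewrite !mulr0n mul0r.
    rewrite !mulr1n ltnS leq_eqVlt; have [->|nj] := eqVneq i j0.
      by rewrite eqxx ltnn mul1r expr1.
    have /negbTE -> : (i : nat) != k by apply: contraNneq nj => h; apply/eqP/val_inj.
    by rewrite mulr1.
  rewrite mulmxA wP // IHk ?(ltnW ltkn) // mulrA; congr (_ * _).
  rewrite [RHS](bigD1 j0) //=; congr (_ * _); apply: eq_bigl => j.
  by rewrite ltnS -val_eqE /= andbC ltn_neqAle.
have := hD n (leqnn n); have -> : D n = diag_mx (\row_j B j j).
  by congr diag_mx; apply/rowP => j; rewrite !mxE ltn_ord.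
by move->; congr (_ * _); apply: eq_bigl => j; rewrite ltn_ord.
Qed.

End HighestWeightVectors.

Section LeftTranslations.
Variables (R : realType) (p n d : nat).
Local Notation C := (Cplx R).
Local Notation mat := 'M[C]_(n, p).
Implicit Types (P Q : mat -> C^o) (F : mat) (Y : (mat -> C^o) -> Prop).

Lemma polynomial_in_trmx (D : pred 'M[nat]_(n, p)) P : polynomial_in D P ->
  polynomial_in (fun e : 'M[nat]_(p, n) => D e^T) (fun F : 'M[C]_(p, n) => P F^T).
Proof.
case=> s hs eP; exists [seq (u.1, u.2^T) | u <- s].
  by rewrite all_map; apply: sub_all hs => u /=; rewrite trmxK.
move=> F; rewrite eP big_map; apply: eq_bigr => u _; congr (_ * _).
rewrite /monomial exchange_big; apply: eq_bigr => i _; apply: eq_bigr => j _.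
by rewrite !mxE.
Qed.

Lemma bounded_degree_trmx P : bounded_degree d P ->
  bounded_degree d (fun F : 'M[C]_(p, n) => P F^T).
Proof.
move=> /polynomial_in_trmx; apply: sub_polynomial_in => e; rewrite !unfold_in.
suff -> : weight (const_mx 1%N) e^T = weight (const_mx 1%N) e by [].
rewrite /weight exchange_big.
by apply: eq_bigr => i _; apply: eq_bigr => j _; rewrite !mxE.
Qed.

Definition left_stable Y : Prop :=
  forall (A : 'M[C]_n) P, A \in unitmx -> Y P -> Y (fun F => P (A *m F)).

End LeftTranslations.

(** Transposition exchanges left and right translations. *)
Lemma lowest_weight_vector (R : realType) (p n d : nat)
    (Y : ('M[Cplx R]_(n, p) -> (Cplx R)^o) -> Prop) : subspace Y ->
  (forall P, Y P -> bounded_degree d P) -> left_stable Y ->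
  (exists2 P, Y P & P <> 0) ->
  exists l P, [/\ Y P, P <> 0
    & forall L : 'M[Cplx R]_n, L \in unitmx -> is_trig_mx L ->
        forall F, P (L *m F) = character l L * P F].
Proof.
move=> sY bY lY [P YP nz].
pose Y' (Q : 'M[Cplx R]_(p, n) -> (Cplx R)^o) := Y (fun F => Q F^T).
have trK (Q : 'M[Cplx R]_(n, p) -> (Cplx R)^o) : (fun F => Q F^T^T) = Q.
  by apply/funext => F; rewrite trmxK.
have sY' : subspace Y'.
  by split; [exact: sY.1 | move=> a Q Q' hQ hQ'; exact: sY.2].
have [|||l [Q [YQ nzQ sQ]]] := highest_weight_vector (d := d) sY'.
- move=> Q /bY/bounded_degree_trmx; congr (bounded_degree _ _).
  by apply/funext => F; rewrite trmxK.
- move=> A Q uA YQ; have := lY A^T _ _ YQ; rewrite unitmx_tr => /(_ uA).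
  by congr (Y _); apply/funext => F; rewrite trmx_mul trmxK.
- exists (fun F => P F^T); first by rewrite /Y' trK.
  move=> h; apply: nz; rewrite -(trK P); apply/funext => F.
  by rewrite -[LHS]/((fun G => P G^T) F^T) h.
exists l, (fun F => Q F^T); split=> //.
  move=> h; apply: nzQ; apply/funext => F.
  by rewrite -[F]trmxK -[LHS]/((fun G => Q G^T) F^T) h.
move=> L uL tL F; rewrite trmx_mul sQ ?unitmx_tr ?trmxK //; congr (_ * _).
by apply: eq_bigr => k _; rewrite mxE.
Qed.

Lemma polynomial_fun_comp (R : realType) (p q p' q' : nat)
    (phi : 'M[Cplx R]_(p', q') -> 'M[Cplx R]_(p, q)) (P : 'M[Cplx R]_(p, q) -> Cplx R) :
  (forall i j, polynomial_fun (fun F => phi F i j)) ->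
  polynomial_fun P -> polynomial_fun (fun F => P (phi F)).
Proof.
move=> hphi [s _ eP].
under [X in polynomial_fun X]eq_fun do rewrite eP.
apply: polynomial_in_sum => u; apply: polynomial_inZ.
by do 2![apply: polynomial_fun_prod => ?]; apply: polynomial_funX.
Qed.

Lemma polynomial_fun_mulmxr (R : realType) (p q r : nat) (A : 'M[Cplx R]_(q, r))
    (P : 'M[Cplx R]_(p, r) -> Cplx R) :
  polynomial_fun P -> polynomial_fun (fun F : 'M_(p, q) => P (F *m A)).
Proof.
apply: (polynomial_fun_comp (phi := mulmxr A)) => i j /=.
under [X in polynomial_fun X]eq_fun do rewrite mxE.
apply: polynomial_in_sum => k.
under [X in polynomial_in _ X]eq_fun do rewrite mulrC.
by apply: polynomial_inZ; apply: polynomial_fun_entry.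
Qed.

Lemma polynomial_fun_mulmx (R : realType) (p q r : nat) (A : 'M[Cplx R]_(p, q))
    (P : 'M[Cplx R]_(p, r) -> Cplx R) :
  polynomial_fun P -> polynomial_fun (fun F : 'M_(q, r) => P (A *m F)).
Proof.
apply: (polynomial_fun_comp (phi := mulmx A)) => i j.
under [X in polynomial_fun X]eq_fun do rewrite mxE.
apply: polynomial_in_sum => k.
by apply: polynomial_inZ; apply: polynomial_fun_entry.
Qed.

Lemma polynomial_fun_det (R : realType) (n : nat) :
  polynomial_fun (fun F : 'M[Cplx R]_n => \det F).
Proof.
apply: polynomial_in_sum => s; apply: polynomial_inZ.
by apply: polynomial_fun_prod => i; apply: polynomial_fun_entry.
Qed.

(** The determinant is a polynomial function, with value 1 at the identity. *)
Lemma polynomial_fun_eq_unitmx (R : realType) (n : nat)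
    (P Q : 'M[Cplx R]_n -> Cplx R) : polynomial_fun P -> polynomial_fun Q ->
  (forall F, F \in unitmx -> P F = Q F) -> P = Q.
Proof.
move=> hP hQ ePQ.
have h0 : (fun F => P F - Q F) = 0.
  apply: (polynomial_fun_eq0 (S := 1%:M) _ (@polynomial_fun_det R n)).
  - exact: polynomial_inB.
  - by rewrite det1 oner_neq0.
  - by move=> F nF; rewrite ePQ ?subrr // unitmxE unitfE.
apply/funext => F; apply/eqP; rewrite -subr_eq0; apply/eqP.
by rewrite -[LHS]/((fun F => P F - Q F) F) h0.
Qed.

(** * Three by three matrices and the big cell *)

Section ThreeByThree.
Variable K : comNzRingType.

Lemma sum3 (W : nmodType) (f : 'I_3 -> W) : \sum_k f k = f 0 + f 1 + f 2.
Proof.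
rewrite !big_ord_recr big_ord0 /= add0r.
by congr (f _ + f _ + f _); apply: val_inj.
Qed.

Lemma prod3 (f : 'I_3 -> K) : \prod_k f k = f 0 * f 1 * f 2.
Proof.
rewrite !big_ord_recr big_ord0 /= mul1r.
by congr (f _ * f _ * f _); apply: val_inj.
Qed.

Lemma ord3P (P : 'I_3 -> Prop) : P 0 -> P 1 -> P 2 -> forall i, P i.
Proof.
move=> h0 h1 h2 [[|[|[|//]]] hi].
- by rewrite (_ : Ordinal hi = 0) //; apply: val_inj.
- by rewrite (_ : Ordinal hi = 1) //; apply: val_inj.
- by rewrite (_ : Ordinal hi = 2) //; apply: val_inj.
Qed.

Lemma matrix3P (A B : 'M[K]_3) :
  A 0 0 = B 0 0 -> A 0 1 = B 0 1 -> A 0 2 = B 0 2 ->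
  A 1 0 = B 1 0 -> A 1 1 = B 1 1 -> A 1 2 = B 1 2 ->
  A 2 0 = B 2 0 -> A 2 1 = B 2 1 -> A 2 2 = B 2 2 -> A = B.
Proof. by move=> *; apply/matrixP; do 2![apply: ord3P]. Qed.

Definition mx3 (a00 a01 a02 a10 a11 a12 a20 a21 a22 : K) : 'M[K]_3 :=
  \matrix_(i, j)
    nth 0 (nth [::] [:: [:: a00; a01; a02]; [:: a10; a11; a12]; [:: a20; a21; a22]] i) j.

Lemma det3 (A : 'M[K]_3) :
  \det A = A 0 0 * (A 1 1 * A 2 2 - A 1 2 * A 2 1)
         - A 0 1 * (A 1 0 * A 2 2 - A 1 2 * A 2 0)
         + A 0 2 * (A 1 0 * A 2 1 - A 1 1 * A 2 0).
Proof.
rewrite (expand_det_row _ 0) sum3 /cofactor.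
have det2 (B : 'M[K]_2) : \det B = B 0 0 * B 1 1 - B 0 1 * B 1 0.
  rewrite (expand_det_row _ 0) !big_ord_recl big_ord0 /cofactor !det_mx11 !mxE /=.
  rewrite addr0 expr0 mul1r expr1 mulN1r mulrN.
  by congr (B _ _ * B _ _ - B _ _ * B _ _); apply: val_inj.
rewrite !det2 !mxE.
have e0 (i : 'I_2) : lift 0 i = if i == 0 then 1 else 2 :> 'I_3.
  by apply: val_inj; case: i => [[|[|]]].
have e1 (i : 'I_2) : lift 1 i = if i == 0 then 0 else 2 :> 'I_3.
  by apply: val_inj; case: i => [[|[|]]].
have e2 (i : 'I_2) : lift 2 i = if i == 0 then 0 else 1 :> 'I_3.
  by apply: val_inj; case: i => [[|[|]]].
by rewrite !e0 !e1 !e2 /=; ring.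
Qed.

Lemma trig3P (A : 'M[K]_3) :
  A 0 1 = 0 -> A 0 2 = 0 -> A 1 2 = 0 -> is_trig_mx A.
Proof.
move=> h01 h02 h12; apply/is_trig_mxP.
by do 2![apply: ord3P].
Qed.

End ThreeByThree.

Section BigCell.
Variable R : realType.
Local Notation C := (Cplx R).
Local Notation mat := 'M[C]_3.

Definition corner_minor (A : mat) : C := A 0 0 * A 1 1 - A 0 1 * A 1 0.

Lemma polynomial_fun_corner_minor : polynomial_fun corner_minor.
Proof.
by apply: polynomial_inB; apply: polynomial_funM; apply: polynomial_fun_entry.
Qed.

(** Gaussian elimination without pivoting. *)
Lemma big_cell_factor (A : mat) : A 0 0 != 0 -> corner_minor A != 0 ->
  A \in unitmx ->
  exists L B : mat, [/\ L \in unitmx, is_trig_mx L, B \in unitmx,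
                       is_trig_mx B^T & A = L *m B].
Proof.
move=> n0 n1 uA.
pose l10 := A 1 0 / A 0 0; pose l20 := A 2 0 / A 0 0.
pose l21 := (A 0 0 * A 2 1 - A 0 1 * A 2 0) / corner_minor A.
pose b11 := A 1 1 - l10 * A 0 1; pose b12 := A 1 2 - l10 * A 0 2.
pose b22 := A 2 2 - l20 * A 0 2 - l21 * b12.
pose L := mx3 1 0 0 l10 1 0 l20 l21 1.
pose B := mx3 (A 0 0) (A 0 1) (A 0 2) 0 b11 b12 0 0 b22.
have eA : A = L *m B.
  apply: matrix3P; rewrite mxE sum3 !mxE /= /b22 /b12 /b11 /l21 /l20 /l10;
    rewrite ?/corner_minor in n1 *; field; by rewrite ?n0 ?n1.
have : A \in unitmx by [].
rewrite {1}eA unitmx_mul => /andP[uL uB].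
exists L, B; split=> //; first by apply: trig3P; rewrite mxE.
by apply: trig3P; rewrite !mxE.
Qed.

(** The big cell is the complement of the hypersurfaces defined by the leading
    minors. *)
Lemma big_cell_dense (P : mat -> C) : polynomial_fun P ->
  (forall L B : mat, L \in unitmx -> is_trig_mx L -> B \in unitmx ->
     is_trig_mx B^T -> P (L *m B) = 0) ->
  P = (fun _ => 0).
Proof.
move=> hP h0.
apply: (@polynomial_fun_eq0 R 3 3 P
          (fun A => A 0 0 * corner_minor A * \det A) 1%:M hP).
- apply: polynomial_funM; last exact: polynomial_fun_det.
  by apply: polynomial_funM; [apply: polynomial_fun_entry
                             | apply: polynomial_fun_corner_minor].
- by rewrite det1 /corner_minor !mxE /= !mulr1n !mulr0n mulr0 subr0 !mulr1 oner_neq0.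
- move=> A; rewrite !mulf_eq0 !negb_or => /andP[/andP[n0 n1] nd].
  have uA : A \in unitmx by rewrite unitmxE unitfE.
  have [L [B [uL tL uB tB ->]]] := big_cell_factor n0 n1 uA.
  exact: h0.
Qed.

End BigCell.

(** * Matrix coefficients of irreducible representations *)

(** Take for U a matrix of maximal rank among those whose rows belong to Y. *)
Lemma subspace_mxP (K : numClosedFieldType) (n : nat) (Y : 'cV[K]_n -> Prop) :
  subspace Y -> exists U : 'M[K]_n, forall u, Y u <-> (u^T <= U)%MS.
Proof.
move=> sY; pose inY (U : 'M[K]_n) := forall u : 'cV[K]_n, (u^T <= U)%MS -> Y u.
pose good k := `[< exists2 U, inY U & \rank U = k >].
have ex0 : exists k, good k.
  exists 0%N; apply/asboolP; exists 0; last exact: mxrank0.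
  move=> u; rewrite submx0 -(trmx0 _ n) => /eqP/trmx_inj ->; exact: sY.1.
have leN k : good k -> (k <= n)%N.
  by move=> /asboolP[U _ <-]; apply: rank_leq_row.
have [k /asboolP[U YU rU] maxk] := ex_maxnP ex0 leN.
exists U => u; split=> [Yu|]; last exact: YU.
pose U' := (U + u^T)%MS.
have YU' : inY U'.
  move=> w /sub_addsmxP[[a b] /= ew].
  have -> : w = (b *m u^T)^T + (a *m U)^T.
    by rewrite -[w]trmxK ew raddfD /= addrC.
  apply: subspaceD => //; last by apply: YU; rewrite trmxK submxMl.
  have -> : (b *m u^T)^T = b 0 0 *: u.
    rewrite trmx_mul trmxK; apply/colP => i.
    by rewrite !mxE big_ord1 !mxE mulrC.
  exact: subspaceZ.
have /maxk : good (\rank U') by apply/asboolP; exists U'.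
rewrite -rU => le_r.
have sUU' : (U <= U')%MS := addsmxSl _ _.
have := mxrank_leqif_sup sUU' => -[_].
rewrite eqn_leq le_r mxrankS //= => /esym sU'.
exact: submx_trans (addsmxSr _ _) sU'.
Qed.

Section MatrixCoefficients.
Variables (R : realType) (r : nat) (V : gl_module R r).
Local Notation C := (Cplx R).
Local Notation mat := 'M[C]_r.

Lemma irreducible_subspace (Y : 'cV[C]_(gl_dim V) -> Prop) :
  irreducible_rep V -> subspace Y ->
  (forall A u, A \in unitmx -> Y u -> Y (gl_act V A *m u)) ->
  (exists2 u, Y u & u <> 0) -> forall u, Y u.
Proof.
move=> [_ irr] sY stY [u Yu nz]; have [U hU] := subspace_mxP sY.
have fullU : row_full U.
  apply: irr => [A uA|]; last first.
    apply/eqP => U0; apply: nz; move: Yu; rewrite hU U0 submx0 -(trmx0 _ (gl_dim V)).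
    by move=> /eqP/trmx_inj.
  apply/row_subP => i; rewrite row_mul.
  rewrite -[row i U]trmxK -trmx_mul; apply/hU; apply: stY => //.
  by apply/hU; rewrite trmxK row_sub.
by move=> w; apply/hU; apply: submx_full.
Qed.

Lemma polynomial_rep_extension : polynomial_rep V ->
  exists rho : mat -> 'M[C]_(gl_dim V),
    (forall a b, polynomial_fun (fun A => rho A a b)) /\
    forall A, A \in unitmx -> rho A = gl_act V A.
Proof.
case=> _ _ hP.
have /choice[f hf] : forall ab : 'I_(gl_dim V) * 'I_(gl_dim V),
    exists P : mat -> C, polynomial_fun P /\
      forall A, A \in unitmx -> gl_act V A ab.1 ab.2 = P A.
  by move=> [a b]; have [P ? ?] := hP a b; exists P.
exists (fun A => \matrix_(a, b) f (a, b) A); split=> [a b|A uA].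
  by under [X in polynomial_fun X]eq_fun do rewrite mxE; case: (hf (a, b)).
by apply/matrixP => a b; rewrite mxE; case: (hf (a, b)) => _ ->.
Qed.

Variable rho : mat -> 'M[C]_(gl_dim V).
Hypotheses (hV : polynomial_rep V)
  (rho_poly : forall a b, polynomial_fun (fun A => rho A a b))
  (rhoE : forall A, A \in unitmx -> rho A = gl_act V A).
Implicit Types (xi : 'rV[C]_(gl_dim V)) (u : 'cV[C]_(gl_dim V)).

Definition matrix_coef xi u : mat -> C^o := fun F => (xi *m rho F *m u) 0 0.

Lemma polynomial_fun_matrix_coef xi u : polynomial_fun (matrix_coef xi u).
Proof.
rewrite /matrix_coef; under [X in polynomial_fun X]eq_fun do rewrite mxE.
apply: polynomial_in_sum => b.
under [X in polynomial_in _ X]eq_fun do rewrite mulrC.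
apply: polynomial_inZ; under [X in polynomial_in _ X]eq_fun do rewrite mxE.
by apply: polynomial_in_sum => a; apply: polynomial_inZ; apply: rho_poly.
Qed.

Lemma matrix_coef_mulmxr xi u A : A \in unitmx ->
  (fun F => matrix_coef xi u (F *m A)) = matrix_coef xi (gl_act V A *m u).
Proof.
move=> uA; apply: polynomial_fun_eq_unitmx.
- exact: (polynomial_fun_mulmxr A (polynomial_fun_matrix_coef xi u)).
- exact: polynomial_fun_matrix_coef.
move=> F uF; case: hV => _ hM _.
by rewrite /matrix_coef !rhoE ?unitmx_mul ?uF // hM // !mulmxA.
Qed.

Lemma matrix_coef_mulmx xi u A : A \in unitmx ->
  (fun F => matrix_coef xi u (A *m F)) = matrix_coef (xi *m gl_act V A) u.
Proof.
move=> uA; apply: polynomial_fun_eq_unitmx.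
- exact: (polynomial_fun_mulmx A (polynomial_fun_matrix_coef xi u)).
- exact: polynomial_fun_matrix_coef.
move=> F uF; case: hV => _ hM _.
by rewrite /matrix_coef !rhoE ?unitmx_mul ?uA // hM // !mulmxA.
Qed.

Lemma matrix_coef_linear xi a u u' :
  matrix_coef xi (a *: u + u') = a *: matrix_coef xi u + matrix_coef xi u'.
Proof.
apply/funext => F.
by rewrite /matrix_coef mulmxDr -scalemxAr 2!mxE.
Qed.

Lemma matrix_coef_linearl a xi xi' u :
  matrix_coef (a *: xi + xi') u = a *: matrix_coef xi u + matrix_coef xi' u.
Proof.
apply/funext => F.
by rewrite /matrix_coef !mulmxDl -!scalemxAl 2!mxE.
Qed.

Lemma matrix_coef1 xi u : matrix_coef xi u 1%:M = (xi *m u) 0 0.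
Proof.
by case: hV => h1 _ _; rewrite /matrix_coef rhoE ?unitmx1 // h1 mulmx1.
Qed.

(** The vectors w with xi (rho F) w = 0 for all F form a subrepresentation. *)
Lemma matrix_coef_eq0 xi u : irreducible_rep V -> u <> 0 ->
  matrix_coef xi u = 0 -> xi = 0.
Proof.
move=> irr nz h0; pose Y w := matrix_coef xi w = 0.
have sY : subspace Y.
  split=> [|a w w' hw hw'].
    by apply/funext => F; rewrite /matrix_coef mulmx0 mxE.
  by rewrite /Y matrix_coef_linear hw hw' scaler0 addr0.
have hY : forall w, Y w.
  apply: irreducible_subspace => //; last by exists u.
  move=> A w uA hw; rewrite /Y -matrix_coef_mulmxr //; apply/funext => F.
  by rewrite hw.
apply/rowP => i; have := matrix_coef1 xi (delta_mx i 0).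
by rewrite hY -colE !mxE.
Qed.

Lemma highest_weight_semi_invariant l xi v :
  (forall A, A \in unitmx -> is_trig_mx A^T ->
     gl_act V A *m v = (\prod_(k < r) A k k ^+ l k) *: v) ->
  semi_invariant l (matrix_coef xi v).
Proof.
move=> hv B uB tB F.
rewrite -[LHS]/((fun F => matrix_coef xi v (F *m B)) F) matrix_coef_mulmxr //.
by rewrite hv // /matrix_coef -scalemxAr mxE.
Qed.

End MatrixCoefficients.

Lemma semi_invariant_bounded (R : realType) (p n : nat) (l : 'I_n -> nat)
    (P : 'M[Cplx R]_(p, n) -> (Cplx R)^o) :
  polynomial_fun P -> semi_invariant l P ->
  bounded_degree (\sum_k l k)%N P.
Proof.
move=> hP sP.
have := polynomial_in_weight (k := (\sum_k l k)%N) (w := const_mx 1%N) hP.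
move=> h; apply: (sub_polynomial_in _ (h _)).
  by move=> e; rewrite !unfold_in /= => /eqP ->.
move=> t F t0.
have -> : scale_entries (const_mx 1%N) t F = F *m t%:M.
  by apply/matrixP => i j; rewrite mul_mx_scalar !mxE.
rewrite sP.
- congr (_ * _); rewrite expr_sum; apply: eq_bigr => k _.
  by rewrite mxE eqxx.
- by rewrite unitmxE det_scalar unitfE expf_neq0.
- apply/is_trig_mxP => i j ltij; rewrite !mxE.
  by rewrite -val_eqE gtn_eqF.
Qed.

Section SemiInvariants.
Variable R : realType.
Local Notation C := (Cplx R).
Local Notation mat := 'M[C]_3.

Definition bi_semi_invariant (l1 l2 : 'I_3 -> nat) (P : mat -> C^o) : Prop :=
  [/\ polynomial_fun P, semi_invariant l2 P
    & forall L : mat, L \in unitmx -> is_trig_mx L ->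
        forall F, P (L *m F) = character l1 L * P F].

(** Both characters are read on the diagonal matrices and the values on the big
    cell on that at the identity, so a weight determines such a function up to a
    factor. *)
Lemma bi_semi_invariant_proportional l1 l1' l P P' : P <> 0 ->
  bi_semi_invariant l1 l P -> bi_semi_invariant l1' l P' ->
  exists c, P' = c *: P.
Proof.
have val l0 Q (L B : mat) : bi_semi_invariant l0 l Q -> L \in unitmx ->
    is_trig_mx L -> B \in unitmx -> is_trig_mx B^T ->
    Q (L *m B) = character l0 L * character l B * Q 1%:M.
  move=> [_ sQ hQ] uL tL uB tB; rewrite hQ // -mulrA; congr (_ * _).
  by rewrite -[B]mul1mx sQ // mul1mx.
have val' l0 Q (L B : mat) : bi_semi_invariant l0 l Q -> L \in unitmx ->
    is_trig_mx L -> B \in unitmx -> is_trig_mx B^T ->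
    Q (L *m B) = character l L * character l B * Q 1%:M.
  move=> hQ uL tL uB tB; rewrite (val _ _ _ _ hQ) //.
  have [->|nz] := eqVneq (Q 1%:M) 0; first by rewrite !mulr0.
  congr (_ * _ * _); pose D : mat := diag_mx (\row_j L j j).
  have uD : D \in unitmx.
    rewrite unitmxE det_diag; under eq_bigr do rewrite mxE.
    by rewrite -det_trig // -unitmxE.
  have eD l2 : character l2 L = character l2 D.
    by apply: eq_bigr => k _; rewrite !mxE eqxx.
  have tD : is_trig_mx D by apply: diag_mx_is_trig.
  have tD' : is_trig_mx D^T by rewrite tr_diag_mx diag_mx_is_trig.
  rewrite !eD; apply: (mulIf nz); case: hQ => _ sQ hQ.
  by rewrite -hQ // mulmx1 -[D]mul1mx sQ // mul1mx.
move=> nzP hP hP'.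
have nz1 : P 1%:M != 0.
  apply/eqP => P1; apply: nzP; apply: big_cell_dense; first by case: hP.
  by move=> L B uL tL uB tB; rewrite (val' _ _ _ _ hP) // P1 mulr0.
exists (P' 1%:M / P 1%:M).
have h0 : (fun F => P' F - (P' 1%:M / P 1%:M) * P F) = (fun _ => 0).
  apply: big_cell_dense.
    apply: polynomial_inB; first by case: hP'.
    by apply: polynomial_inZ; case: hP.
  move=> L B uL tL uB tB; rewrite (val' _ _ _ _ hP) // (val' _ _ _ _ hP') //.
  by field.
apply/funext => F; apply/eqP; rewrite -subr_eq0; apply/eqP.
by rewrite -[RHS]/((fun _ : mat => 0) F) -h0.
Qed.

(** The functions xi (rho F) v form a space stable under left translations, and
    so do the semi-invariants orthogonal to them. If the second space were nonzero,
    both would contain a function semi-invariant on the two sides; such functions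
    are proportional, so one of them would be orthogonal to itself. *)
Lemma semi_invariant_matrix_coef (V : gl_module R 3)
    (rho : mat -> 'M[C]_(gl_dim V)) l (v : 'cV[C]_(gl_dim V)) (P : mat -> C^o) :
  polynomial_rep V ->
  (forall a b, polynomial_fun (fun A => rho A a b)) ->
  (forall A, A \in unitmx -> rho A = gl_act V A) ->
  v != 0 ->
  (forall A, A \in unitmx -> is_trig_mx A^T ->
     gl_act V A *m v = (\prod_(k < 3) A k k ^+ l k) *: v) ->
  polynomial_fun P -> semi_invariant l P ->
  exists xi, P = matrix_coef rho xi v.
Proof.
move=> hV prho rhoE nzv hv hP sP.
pose d := (\sum_k l k)%N; pose form := @kernel_form R 3 3 d.
have hform : hermitian_on (@bounded_degree R 3 3 d) form by apply: kernel_form_hermitian.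
pose Y (Q : mat -> C^o) := exists xi, Q = matrix_coef rho xi v.
pose T (Q : mat -> C^o) := polynomial_fun Q /\ semi_invariant l Q.
have sT : subspace T.
  by apply: subspaceI; [apply: polynomial_in_subspace | apply: semi_invariant_subspace].
have bT Q : T Q -> bounded_degree d Q by case; apply: semi_invariant_bounded.
have lT : left_stable T.
  move=> A Q uA [pQ sQ]; split; first exact: polynomial_fun_mulmx.
  by move=> B uB tB F; rewrite mulmxA sQ.
have YT Q : Y Q -> T Q.
  case=> xi ->; split; first exact: polynomial_fun_matrix_coef.
  exact: highest_weight_semi_invariant.
have bY Q : Y Q -> bounded_degree d Q by move/YT/bT.
have sY : subspace Y.
  split=> [|a _ _ [xi ->] [xi' ->]].
    by exists 0; apply/funext => F; rewrite /matrix_coef !mul0mx mxE.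
  by exists (a *: xi + xi'); rewrite matrix_coef_linearl.
have lY : left_stable Y.
  move=> A _ uA [xi ->]; exists (xi *m gl_act V A).
  exact: (matrix_coef_mulmx hV prho rhoE).
have [P1 YP1 oP1] := ortho_projection hform (@bounded_degree_subspace _ _ _ _)
  (@bounded_degree_finite_span _ _ _ _) sY bY (bT _ (conj hP sP)).
suff h0 : P - P1 = 0.
  by case: YP1 => xi eP1; exists xi; rewrite -eP1; apply/eqP; rewrite -subr_eq0 h0.
apply: contrapT => nzP.
pose Y2 Q := T Q /\ forall Q', Y Q' -> form Q Q' = 0.
have sY2 : subspace Y2.
  apply: subspaceI => //; split=> [Q' _|a Q1 Q2 h1 h2 Q' YQ'].
    exact: (form0l _ hform).
  by rewrite (formDl _ _ _ hform) (formZl _ _ _ hform) h1 // h2 // mulr0 addr0.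
have lY2 : left_stable Y2.
  move=> A Q uA [TQ oQ]; split; first exact: lT.
  move=> Q' YQ'; have bQ : bounded_degree d (fun F => Q (A *m F)).
    by apply: bT; apply: lT.
  rewrite /form (kernel_form_left (bT _ TQ) bQ (bY _ YQ')).
  apply: oQ; apply: lY => //.
  by rewrite /adjmx map_unitmx unitmx_tr.
have [|||l1 [Q1 [Y2Q1 nzQ1 lQ1]]] := lowest_weight_vector (d := d) sY2.
- by move=> Q [/bT].
- exact: lY2.
- by exists (P - P1) => //; split; [apply: subspaceB => //; apply: YT | exact: oP1].
have [|||l2 [Q2 [YQ2 nzQ2 lQ2]]] := lowest_weight_vector (d := d) sY.
- exact: bY.
- exact: lY.
- case/cV0Pn: nzv => i vi; exists (matrix_coef rho (delta_mx 0 i) v).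
    by exists (delta_mx 0 i).
  move=> h0; move: vi; have := matrix_coef1 hV rhoE (delta_mx 0 i) v.
  by rewrite h0 -rowE mxE => <-; rewrite eqxx.
have [c eQ1] : exists c, Q1 = c *: Q2.
  apply: (bi_semi_invariant_proportional (l1 := l2) (l1' := l1) (l := l)) => //.
    by have [? ?] := YT _ YQ2; split.
  by have [[? ?] _] := Y2Q1; split.
have c0 : c != 0 by apply/eqP => c0; apply: nzQ1; rewrite eQ1 c0 scale0r.
have := Y2Q1.2 _ YQ2; rewrite eQ1 (formZl _ _ _ hform) => /eqP.
rewrite mulf_eq0 (negbTE c0) /= => /eqP Q20; apply: nzQ2.
by have [_ _] := hform; apply => //; apply: bY.
Qed.

End SemiInvariants.

(** * Highest weight vectors among invariant jet differentials *)

Section InvariantJets.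
Variable R : realType.
Local Notation C := (Cplx R).
Local Notation jet := 'M[C]_3.
Implicit Types (F G : jet) (Q : jet -> C^o) (l : 'I_3 -> nat).

Definition reparam_mx (a1 a2 a3 : C) : jet :=
  mx3 a1 0 0 a2 (a1 ^+ 2) 0 a3 (3%:R * a1 * a2) (a1 ^+ 3).

Lemma reparamE a1 a2 a3 F : reparam a1 a2 a3 F = reparam_mx a1 a2 a3 *m F.
Proof.
by apply/matrixP => i j; rewrite [RHS]mxE sum3 !mxE; move: i; apply: ord3P;
  rewrite /= !mxE; ring.
Qed.

Lemma invariant_jet_subspace m :
  subspace (@invariant_jet_differential R m : (jet -> C^o) -> Prop).
Proof.
apply: subspaceI; first exact: polynomial_in_subspace.
split=> [a1 a2 a3 F _|a P Q hP hQ a1 a2 a3 F a10].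
  by rewrite -[RHS]/(_ * 0) mulr0.
have e G : (a *: P + Q) G = a * P G + Q G by [].
by rewrite !e hP // hQ //; ring.
Qed.

Lemma invariant_jet_right_stable m :
  right_stable (@invariant_jet_differential R m : (jet -> C^o) -> Prop).
Proof.
move=> A Q _ [pQ hQ]; split; first exact: polynomial_fun_mulmxr.
by move=> a1 a2 a3 F a10; rewrite reparamE -mulmxA -reparamE hQ.
Qed.

Definition jet_weight : 'M[nat]_3 := \matrix_(i, j) i.+1.

Lemma invariant_jet_weight m Q (D : pred 'M[nat]_3) :
  polynomial_in D Q -> invariant_jet_differential m Q ->
  polynomial_in (fun e => D e && (weight jet_weight e == m)) Q.
Proof.
move=> pQ [_ hQ]; apply: polynomial_in_weight => // t F t0.
rewrite -(hQ t 0 0) //; congr Q; rewrite reparamE; apply/matrixP => i j.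
by rewrite [RHS]mxE sum3 !mxE; move: i; apply: ord3P; rewrite /=; ring.
Qed.

Lemma invariant_jet_bounded m Q :
  invariant_jet_differential m Q -> bounded_degree m Q.
Proof.
move=> hQ; have := invariant_jet_weight hQ.1 hQ; apply: sub_polynomial_in => e.
rewrite !unfold_in /= => /eqP <-; apply: leq_sum => i _; apply: leq_sum => j _.
by rewrite !mxE leq_mul2r orbT.
Qed.

(** With w = x y' - y x' the Wronskian of the first two coordinates x and y,
    this is x w' - 3 x' w. *)
Definition bordered_minor F : C :=
  F 0 0 * (F 0 0 * F 2 1 - F 0 1 * F 2 0) - 3%:R * F 1 0 * corner_minor F.

Lemma polynomial_fun_bordered_minor : polynomial_fun bordered_minor.
Proof.
apply: polynomial_inB; last first.
  apply: polynomial_funM; last exact: polynomial_fun_corner_minor.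
  by apply: polynomial_inZ; apply: polynomial_fun_entry.
apply: polynomial_funM; first exact: polynomial_fun_entry.
by apply: polynomial_inB; apply: polynomial_funM; apply: polynomial_fun_entry.
Qed.

(** The functions x, w, q and det of F all take the value 1 at this point. *)
Definition base_jet : jet := mx3 1 0 0 0 1 0 0 1 1.

(** For a jet F in general position there are a unique reparametrization, of
    linear part a = x w / q, and a unique upper triangular matrix that bring F to
    the base jet. *)
Lemma invariant_jet_value m l Q F : invariant_jet_differential m Q ->
  semi_invariant l Q ->
  F 0 0 != 0 -> corner_minor F != 0 -> bordered_minor F != 0 -> \det F != 0 ->
  let a := F 0 0 * corner_minor F / bordered_minor F in
  a ^+ m * Q F = (a * F 0 0) ^+ l 0 * (a ^+ 2 * corner_minor F / F 0 0) ^+ l 1 *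
                 (a ^+ 3 * \det F / corner_minor F) ^+ l 2 * Q base_jet.
Proof.
move=> [_ hQ] sQ nx nw nq nD a.
have a0 : a != 0 by rewrite !mulf_neq0 // invr_neq0.
(* a2 and a3 cancel the entries of G below x; the value of a makes G 2 1 and
   G 1 1 equal. *)
pose a2 := - (a ^+ 2 * F 1 0 / F 0 0).
pose a3 := - ((a ^+ 3 * F 2 0 + 3%:R * a * a2 * F 1 0) / F 0 0).
have [G eGF] : exists G, G = reparam_mx a a2 a3 *m F by exists (reparam_mx a a2 a3 *m F).
have G0 j : G 0 j = a * F 0 j by rewrite eGF mxE sum3 !mxE /=; ring.
have G1 j : G 1 j = a2 * F 0 j + a ^+ 2 * F 1 j by rewrite eGF mxE sum3 !mxE /=; ring.
have G2 j : G 2 j = a3 * F 0 j + 3%:R * a * a2 * F 1 j + a ^+ 3 * F 2 j.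
  by rewrite eGF mxE sum3 !mxE /=; ring.
have G10 : G 1 0 = 0 by rewrite G1 /a2; field.
have G20 : G 2 0 = 0 by rewrite G2 /a3; field.
have G11 : G 1 1 = a ^+ 2 * corner_minor F / F 0 0.
  by rewrite G1 /a2 /corner_minor; field.
have eq2 : G 2 1 = a ^+ 3 * bordered_minor F / F 0 0 ^+ 2.
  rewrite G2 /a3 /a2 /bordered_minor /corner_minor.
  by field; rewrite nx.
have G21 : G 2 1 = G 1 1.
  rewrite eq2 G11 /a; field; by rewrite nq nx.
pose B := mx3 (G 0 0) (G 0 1) (G 0 2) 0 (G 1 1) (G 1 2) 0 0 (G 2 2 - G 1 2).
have eG : G = base_jet *m B.
  apply: matrix3P; rewrite [RHS]mxE sum3 !mxE /= ?G10 ?G20 ?G21; ring.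
have detG : \det G = G 0 0 * G 1 1 * (G 2 2 - G 1 2).
  by rewrite det3 G10 G20 G21; ring.
have B22 : G 2 2 - G 1 2 = a ^+ 3 * \det F / corner_minor F.
  have : \det G = a ^+ 6 * \det F.
    rewrite eGF det_mulmx; congr (_ * _).
    by rewrite det3 !mxE /=; ring.
  rewrite detG G0 G11 => h.
  have -> : a ^+ 3 * \det F / corner_minor F =
      (a ^+ 6 * \det F) / (a ^+ 3 * corner_minor F) by field; rewrite nw a0.
  by rewrite -h; field; rewrite nw nx a0.
have tB : is_trig_mx B^T by apply: trig3P; rewrite !mxE.
have chB : \det B = G 0 0 * G 1 1 * (G 2 2 - G 1 2).
  by rewrite det3 !mxE /=; ring.
have uB : B \in unitmx.
  rewrite unitmxE unitfE chB G0 G11 B22.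
  by rewrite !mulf_neq0 ?invr_neq0 ?expf_neq0.
rewrite -(hQ a a2 a3 F a0) reparamE -eGF eG sQ // /character prod3 !mxE /=.
by rewrite G0 G11 B22.
Qed.

Lemma invariant_jet_generic (P : jet -> C) : polynomial_fun P ->
  (forall F, F 0 0 != 0 -> corner_minor F != 0 -> bordered_minor F != 0 ->
     \det F != 0 -> P F = 0) -> P = (fun _ => 0).
Proof.
move=> hP h0.
apply: (@polynomial_fun_eq0 R 3 3 P
  (fun F => F 0 0 * corner_minor F * bordered_minor F * \det F) base_jet hP).
- apply: polynomial_funM; last exact: polynomial_fun_det.
  apply: polynomial_funM; last exact: polynomial_fun_bordered_minor.
  by apply: polynomial_funM; [apply: polynomial_fun_entry
                             | apply: polynomial_fun_corner_minor].
- rewrite det3 /bordered_minor /corner_minor !mxE /=.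
  by rewrite (_ : _ * _ = 1) ?oner_neq0 //; ring.
- move=> F; rewrite !mulf_eq0 !negb_or => /andP[/andP[/andP[? ?] ?] ?].
  exact: h0.
Qed.

Lemma invariant_jet_base m l Q : invariant_jet_differential m Q ->
  semi_invariant l Q -> Q base_jet = 0 -> Q = 0.
Proof.
move=> hQ sQ Q0; apply: invariant_jet_generic; first by case: hQ.
move=> F nx nw nq nD; have /= := invariant_jet_value hQ sQ nx nw nq nD.
rewrite (Q0 : (Q base_jet : C) = 0) mulr0 => /eqP.
rewrite mulf_eq0 expf_eq0 => /orP[/andP[_]|/eqP//].
by rewrite !mulf_eq0 invr_eq0 (negbTE nx) (negbTE nw) (negbTE nq).
Qed.

(** Otherwise r would have a pole at 0. *)
Lemma polynomial_order_le (r : {poly C}) (c : C) k k' : c != 0 ->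
  (forall t, t != 0 -> t ^+ k * r.[t] = c * t ^+ k') -> (k <= k')%N.
Proof.
move=> c0 h; have e : 'X^k * r = c%:P * 'X^k'.
  by apply: poly_eq_nz => t t0; rewrite !(hornerM, hornerC, hornerXn) h.
rewrite leqNgt; apply/negP => ltk.
have := congr1 (fun s : {poly C} => s`_k') e.
rewrite coefXnM ltk coefCM coefXn eqxx mulr1 => /eqP.
by rewrite eq_sym (negbTE c0).
Qed.

(** The inequalities on the weight express that Q has no pole along the three
    hypersurfaces q = 0, x = 0 and w = 0. *)
Lemma invariant_jet_weight_bounds m l Q : invariant_jet_differential m Q ->
  semi_invariant l Q -> Q <> 0 ->
  [/\ (l 0%R + 2 * l 1%R + 3 * l 2%R <= m)%N,
      (m <= 2 * l 0%R + l 1%R + 3 * l 2%R)%N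
    & (m <= l 0%R + 3 * l 1%R + 2 * l 2%R)%N].
Proof.
move=> hQ sQ nz; have pQ := hQ.1.
have nb : Q base_jet != 0 by apply/eqP => /(invariant_jet_base hQ sQ).
have n3 : (3%:R : C) != 0 by rewrite pnatr_eq0.
have e3 k : (3 * k = k + k + k)%N by lia.
split.
- (* Along this curve q = t, while x, w and the determinant are 1. *)
  pose G : 'M[{poly C}]_3 := mx3 1 0 0 0 1 0 0 'X 1.
  have [r hr] := polynomial_fun_curve G pQ.
  apply: (polynomial_order_le (r := r) nb) => t t0; rewrite hr.
  set F := map_mx _ _.
  have eF : F = mx3 1 0 0 0 1 0 0 t 1.
    by apply: matrix3P; rewrite !mxE /= ?hornerX ?hornerC.
  have ex : F 0 0 = 1 by rewrite eF mxE.
  have ew : corner_minor F = 1 by rewrite eF /corner_minor !mxE /=; ring.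
  have eq_ : bordered_minor F = t by rewrite /bordered_minor ew eF !mxE /=; ring.
  have eD : \det F = 1 by rewrite det3 eF !mxE /=; ring.
  have := invariant_jet_value hQ sQ (F := F).
  rewrite ex ew eq_ eD oner_neq0 => /(_ isT isT t0 isT) /=.
  rewrite !mul1r !mulr1 !divr1 -!exprM -!exprD => h.
  have -> : Q F = t ^+ m * (t^-1 ^+ m * Q F) by rewrite exprVn mulrA mulfV ?expf_neq0 // mul1r.
  rewrite h exprVn [RHS]mulrC mulrCA; congr (_ * _).
  by rewrite mulrA mulfV ?mul1r // expf_neq0.
- (* Along this curve x = t, while w, q and the determinant are constant. *)
  pose G : 'M[{poly C}]_3 := mx3 'X 1 0 1 0 0 0 0 1.
  have [r hr] := polynomial_fun_curve G pQ.
  set c := ((- 3%:R^-1) ^+ m)^-1 * ((- 3%:R^-1) ^+ l 0 * (- (9%:R)^-1) ^+ l 1 *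
      (- (27%:R)^-1) ^+ l 2 * Q base_jet).
  have c0 : c != 0.
    by rewrite !mulf_neq0 ?invr_neq0 ?expf_neq0 ?oppr_eq0 ?invr_neq0 ?pnatr_eq0.
  apply: (polynomial_order_le (r := r) c0) => t t0; rewrite hr.
  set F := map_mx _ _.
  have eF : F = mx3 t 1 0 1 0 0 0 0 1.
    by apply: matrix3P; rewrite !mxE /= ?hornerX ?hornerC.
  have ex : F 0 0 = t by rewrite eF mxE.
  have ew : corner_minor F = -1 by rewrite eF /corner_minor !mxE /=; ring.
  have eq_ : bordered_minor F = 3%:R by rewrite /bordered_minor ew eF !mxE /=; ring.
  have eD : \det F = -1 by rewrite det3 eF !mxE /=; ring.
  have := invariant_jet_value hQ sQ (F := F).
  rewrite ex ew eq_ eD oppr_eq0 oner_neq0 n3 => /(_ t0 isT isT isT) /=.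
  have -> : t * -1 / 3%:R = (- 3%:R^-1) * t by ring.
  have -> : - 3%:R^-1 * t * t = (- 3%:R^-1) * t ^+ 2 by ring.
  have -> : (- 3%:R^-1 * t) ^+ 2 * -1 / t = (- 9%:R^-1) * t by field.
  have -> : (- 3%:R^-1 * t) ^+ 3 * -1 / -1 = (- 27%:R^-1) * t ^+ 3 by field.
  rewrite !exprMn => h.
  have -> : t ^+ m * Q F =
      ((- 3%:R^-1) ^+ m)^-1 * ((- 3%:R^-1) ^+ m * t ^+ m * Q F).
    by field; rewrite expf_neq0 // oppr_eq0 invr_neq0.
  by rewrite h /c mul2n -addnn e3 !exprD; ring.
- (* Along this curve w = t, while x, q and the determinant are constant. *)
  pose G : 'M[{poly C}]_3 := mx3 1 0 0 0 'X 1 0 1 0.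
  have [r hr] := polynomial_fun_curve G pQ.
  set c := (-1) ^+ l 2 * Q base_jet.
  have c0 : c != 0.
    by rewrite mulf_neq0 // expf_neq0 // oppr_eq0 oner_neq0.
  apply: (polynomial_order_le (r := r) c0) => t t0; rewrite hr.
  set F := map_mx _ _.
  have eF : F = mx3 1 0 0 0 t 1 0 1 0.
    by apply: matrix3P; rewrite !mxE /= ?hornerX ?hornerC.
  have ex : F 0 0 = 1 by rewrite eF mxE.
  have ew : corner_minor F = t by rewrite eF /corner_minor !mxE /=; ring.
  have eq_ : bordered_minor F = 1 by rewrite /bordered_minor ew eF !mxE /=; ring.
  have eD : \det F = -1 by rewrite det3 eF !mxE /=; ring.
  have := invariant_jet_value hQ sQ (F := F).
  rewrite ex ew eq_ eD oppr_eq0 oner_neq0 => /(_ isT t0 isT isT) /=.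
  have -> : 1 * t / 1 = t by field.
  have -> : t ^+ 2 * t / 1 = t ^+ 3 by field.
  have -> : t ^+ 3 * -1 / t = -1 * t ^+ 2 by field.
  rewrite mulr1 !exprMn => ->.
  by rewrite /c mul2n -addnn e3 !exprD; ring.
Qed.

End InvariantJets.

Section HighestWeightJets.
Variable R : realType.
Local Notation C := (Cplx R).
Local Notation jet := 'M[C]_3.
Implicit Types (F G : jet) (Q : jet -> C^o) (l : 'I_3 -> nat).

Definition highest_weight_jet l (g : nat) : jet -> C^o := fun F =>
  F 0 0 ^+ (l 0%R - l 1%R - g) * corner_minor F ^+ (l 1%R - l 2%R - g)
  * bordered_minor F ^+ g * (\det F) ^+ l 2.

Lemma reparam_generators a1 a2 a3 F : let G := reparam_mx a1 a2 a3 *m F in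
  [/\ G 0 0 = a1 * F 0 0, corner_minor G = a1 ^+ 3 * corner_minor F,
      bordered_minor G = a1 ^+ 5 * bordered_minor F
    & \det G = a1 ^+ 6 * \det F].
Proof.
move=> G.
have G0 j : G 0 j = a1 * F 0 j by rewrite mxE sum3 !mxE /=; ring.
have G1 j : G 1 j = a2 * F 0 j + a1 ^+ 2 * F 1 j by rewrite mxE sum3 !mxE /=; ring.
have G2 j : G 2 j = a3 * F 0 j + 3%:R * a1 * a2 * F 1 j + a1 ^+ 3 * F 2 j.
  by rewrite mxE sum3 !mxE /=; ring.
split=> //.
- by rewrite /corner_minor !(G0, G1); ring.
- by rewrite /bordered_minor /corner_minor !(G0, G1, G2); ring.
- by rewrite det_mulmx; congr (_ * _); rewrite det3 !mxE /=; ring.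
Qed.

Lemma upper_generators (B : jet) F : is_trig_mx B^T ->
  [/\ (F *m B) 0 0 = B 0 0 * F 0 0,
      corner_minor (F *m B) = B 0 0 * B 1 1 * corner_minor F,
      bordered_minor (F *m B) = B 0 0 ^+ 2 * B 1 1 * bordered_minor F
    & \det (F *m B) = B 0 0 * B 1 1 * B 2 2 * \det F].
Proof.
move=> tB; have B0 (i j : 'I_3) : (j < i)%N -> B i j = 0.
  by move=> ltji; have /is_trig_mxP/(_ j i ltji) := tB; rewrite mxE.
have e0 i : (F *m B) i 0 = F i 0 * B 0 0.
  by rewrite mxE sum3 (B0 1 0) // (B0 2 0) //; ring.
have e1 i : (F *m B) i 1 = F i 0 * B 0 1 + F i 1 * B 1 1.
  by rewrite mxE sum3 (B0 2 1) //; ring.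
split.
- by rewrite e0 mulrC.
- by rewrite /corner_minor !(e0, e1); ring.
- by rewrite /bordered_minor /corner_minor !(e0, e1); ring.
- by rewrite det_mulmx -(det_tr B) (det_trig tB) prod3 !mxE mulrC.
Qed.

Lemma highest_weight_jet_invariant l g m :
  (l 1%R + g <= l 0%R)%N -> (l 2%R + g <= l 1%R)%N ->
  m = (l 0%R + 2 * l 1%R + 3 * l 2%R + g)%N ->
  invariant_jet_differential m (highest_weight_jet l g).
Proof.
move=> h1 h2 ->; split=> [|a1 a2 a3 F a10].
  apply: polynomial_funM; last first.
    exact: (polynomial_funX _ (@polynomial_fun_det R 3)).
  apply: polynomial_funM; last first.
    exact: (polynomial_funX _ (@polynomial_fun_bordered_minor R)).
  apply: polynomial_funM.
    exact: (polynomial_funX _ (@polynomial_fun_entry R 3 3 0 0)).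
  exact: (polynomial_funX _ (@polynomial_fun_corner_minor R)).
have [e1 e2 e3 e4] := reparam_generators a1 a2 a3 F.
have ex n k (y : C) : (a1 ^+ n * y) ^+ k = a1 ^+ (n * k) * y ^+ k.
  by rewrite exprMn exprM.
rewrite reparamE /highest_weight_jet e1 e2 e3 e4 !ex exprMn.
have -> : (l 0%R + 2 * l 1%R + 3 * l 2%R + g =
  (l 0%R - l 1%R - g) + 3 * (l 1%R - l 2%R - g) + 5 * g + 6 * l 2%R)%N by lia.
by rewrite !exprD; ring.
Qed.

Lemma highest_weight_jet_semi_invariant l g :
  (l 1%R + g <= l 0%R)%N -> (l 2%R + g <= l 1%R)%N ->
  semi_invariant l (highest_weight_jet l g).
Proof.
move=> h1 h2 B uB tB F; have [e1 e2 e3 e4] := upper_generators F tB.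
rewrite /highest_weight_jet e1 e2 e3 e4.
set a := (l 0%R - l 1%R - g)%N; set b := (l 1%R - l 2%R - g)%N.
have E0 : l 0%R = (a + b + (g + g) + l 2%R)%N by lia.
have E1 : l 1%R = (b + g + l 2%R)%N by lia.
by rewrite /character prod3 E0 E1 !exprMn !exprD; ring.
Qed.

Lemma highest_weight_jet_base l g : highest_weight_jet l g (base_jet R) = 1.
Proof.
rewrite /highest_weight_jet.
have -> : (base_jet R) 0 0 = 1 by rewrite mxE.
have -> : corner_minor (base_jet R) = 1 by rewrite /corner_minor !mxE /=; ring.
have -> : bordered_minor (base_jet R) = 1.
  by rewrite /bordered_minor /corner_minor !mxE /=; ring.
have -> : \det (base_jet R) = 1 by rewrite det3 !mxE /=; ring.
by rewrite !expr1n !mulr1.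
Qed.

(** The weights of the irreducible components of the invariant jet
    differentials of degree m; the excess m - (l0 + 2 l1 + 3 l2) is the
    parameter gamma of the decomposition. *)
Definition jet_weights (m : nat) l : Prop := exists g,
  [/\ (l 1%R + g <= l 0%R)%N, (l 2%R + g <= l 1%R)%N
    & m = (l 0%R + 2 * l 1%R + 3 * l 2%R + g)%N].

Lemma jet_weights_highest m l : jet_weights m l ->
  exists Q, [/\ invariant_jet_differential m Q, semi_invariant l Q & Q <> 0].
Proof.
move=> [g [h1 h2 em]]; exists (highest_weight_jet l g); split.
- exact: highest_weight_jet_invariant.
- exact: highest_weight_jet_semi_invariant.
- move=> h0; have := highest_weight_jet_base l g; rewrite h0 => /esym/eqP.
  by rewrite -[X in _ == X]/(0 : C) oner_eq0.
Qed.

Lemma highest_jet_weights m l Q : invariant_jet_differential m Q ->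
  semi_invariant l Q -> Q <> 0 -> jet_weights m l.
Proof.
move=> hQ sQ nz; have [b1 b2 b3] := invariant_jet_weight_bounds hQ sQ nz.
by exists (m - (l 0%R + 2 * l 1%R + 3 * l 2%R))%N; split; lia.
Qed.

Lemma highest_jet_proportional m l Q Q' : invariant_jet_differential m Q ->
  semi_invariant l Q -> Q <> 0 ->
  invariant_jet_differential m Q' -> semi_invariant l Q' ->
  exists c, Q' = c *: Q.
Proof.
move=> hQ sQ nz hQ' sQ'.
have nb : (Q (base_jet R) : C) != 0 by apply/eqP => /(invariant_jet_base hQ sQ).
exists (Q' (base_jet R) / Q (base_jet R)).
set c := _ / _.
have h0 : Q' - c *: Q = 0.
  apply: (invariant_jet_base (m := m) (l := l)).
  - have sE := @invariant_jet_subspace R m.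
    exact: (subspaceB sE hQ' (subspaceZ c sE hQ)).
  - have sI := @semi_invariant_subspace R 3 3 l.
    exact: (subspaceB sI sQ' (subspaceZ c sI sQ)).
  - rewrite -[LHS]/(Q' (base_jet R) - c * Q (base_jet R)) /c.
    by rewrite divfK // subrr.
by apply/eqP; rewrite -subr_eq0 h0.
Qed.

End HighestWeightJets.

(** * Irreducible components of the invariant jet differentials *)

Section Components.
Variables (R : realType) (m : nat).
Local Notation C := (Cplx R).
Local Notation jet := 'M[C]_3.
Local Notation invariant := (@invariant_jet_differential R m : (jet -> C^o) -> Prop).
Local Notation form := (@kernel_form R 3 3 m).
Implicit Types (P Q : jet -> C^o) (Y Z : (jet -> C^o) -> Prop).

Let form_herm : hermitian_on (@bounded_degree R 3 3 m) form :=
  @kernel_form_hermitian R 3 3 m.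

Let inv_sub : subspace invariant := @invariant_jet_subspace R m.

Let inv_bounded P : invariant P -> bounded_degree m P :=
  @invariant_jet_bounded R m P.

Lemma invariant_form_hermitian : hermitian_on invariant form.
Proof.
have [hl hc hd] := form_herm; split=> // [P Q /inv_bounded hP /inv_bounded hQ|P].
  exact: hc.
by move=> /inv_bounded; apply: hd.
Qed.
Let hform := invariant_form_hermitian.

Lemma invariant_finite_span : finite_span invariant.
Proof.
have [T [b hb]] := @bounded_degree_finite_span R 3 3 m.
by exists T, b => P /inv_bounded; apply: hb.
Qed.

Lemma invariant_form_mulmxr (A : jet) P Q : A \in unitmx ->
  invariant P -> invariant Q ->
  form (fun F => P (F *m A)) Q = form P (fun F => Q (F *m adjmx A)).
Proof.
move=> uA hP hQ; apply: kernel_form_right; try exact: inv_bounded.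
by apply: inv_bounded; apply: invariant_jet_right_stable.
Qed.

Lemma adjmx_unit (A : jet) : A \in unitmx -> adjmx A \in unitmx.
Proof. by rewrite /adjmx map_unitmx unitmx_tr. Qed.

Lemma orthogonal_subspace Y Z : subspace Y ->
  subspace (fun P => Y P /\ forall Q, Z Q -> form P Q = 0).
Proof.
move=> sY; apply: subspaceI => //; split=> [Q _|a P1 P2 h1 h2 Q ZQ].
  exact: (form0l _ hform).
by rewrite (formDl _ _ _ hform) (formZl _ _ _ hform) h1 // h2 // mulr0 addr0.
Qed.

Lemma orthogonal_right_stable Y Z : right_stable Y -> right_stable Z ->
  (forall P, Y P -> invariant P) -> (forall P, Z P -> invariant P) ->
  right_stable (fun P => Y P /\ forall Q, Z Q -> form P Q = 0).
Proof.
move=> rY rZ YE ZE A P uA [YP oP]; split=> [|Q ZQ]; first exact: rY.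
rewrite invariant_form_mulmxr //; [|exact: YE|exact: ZE].
by apply: oP; apply: rZ => //; apply: adjmx_unit.
Qed.

Lemma invariant_highest_weight Y : subspace Y -> right_stable Y ->
  (forall P, Y P -> invariant P) -> (exists2 P, Y P & P <> 0) ->
  exists l P, [/\ Y P, P <> 0, semi_invariant l P & jet_weights m l].
Proof.
move=> sY rY YE nY.
have [|l [P [YP nz sP]]] := highest_weight_vector (d := m) sY _ rY nY.
  by move=> P /YE/inv_bounded.
by exists l, P; split=> //; apply: (highest_jet_weights (YE _ YP) sP nz).
Qed.

Definition jet_embedding l (V : gl_module R 3)
    (psi : 'cV[C]_(gl_dim V) -> jet -> C^o) : Prop :=
  [/\ forall a u u', psi (a *: u + u') = a *: psi u + psi u',
      forall A u, A \in unitmx ->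
        psi (gl_act V A *m u) = (fun F => psi u (F *m A)),
      forall u, invariant (psi u)
    & exists v, [/\ psi v <> 0 & semi_invariant l (psi v)]].

(** An irreducible representation of highest weight l embeds through the matrix
    coefficients u |-> xi (rho F) u, with xi chosen so that the highest weight
    vector goes to a prescribed invariant jet differential of weight l. *)
Lemma jet_embedding_exists l (V : gl_module R 3) : polynomial_rep V ->
  irreducible_rep V -> has_highest_weight l V -> jet_weights m l ->
  exists psi, @jet_embedding l V psi.
Proof.
move=> hV irr [v nzv hv] /(jet_weights_highest R)[Q [hQ sQ nzQ]].
have [rho [prho rhoE]] := polynomial_rep_extension hV.
have [xi eQ] := semi_invariant_matrix_coef hV prho rhoE nzv hv hQ.1 sQ.
exists (matrix_coef rho xi).
have lin a u u' := @matrix_coef_linear R 3 V rho xi a u u'.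
have equ A u uA := @matrix_coef_mulmxr R 3 V rho hV prho rhoE xi u A uA.
split=> //; last by exists v; rewrite -eQ.
  by move=> A u uA; rewrite equ.
apply: (irreducible_subspace irr).
- split=> [|a u u' hu hu']; last by rewrite lin; apply: inv_sub.2.
  have -> : matrix_coef rho xi 0 = 0.
    by apply/funext => F; rewrite /matrix_coef mulmx0 mxE.
  exact: inv_sub.1.
- move=> A u uA hu; have := @invariant_jet_right_stable R m A _ uA hu.
  by rewrite (equ A u uA).
- by exists v; [rewrite -eQ | apply/eqP].
Qed.

Section OneComponent.
Variables (l : 'I_3 -> nat) (V : gl_module R 3).
Variable psi : 'cV[C]_(gl_dim V) -> jet -> C^o.
Hypotheses (hV : polynomial_rep V) (irr : irreducible_rep V)
  (hpsi : jet_embedding l psi).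

Lemma embedding0 : psi 0 = 0.
Proof.
have [lin _ _ _] := hpsi; have := lin (-1) 0 0.
by rewrite scaler0 addr0 scaleN1r addNr.
Qed.

Lemma embeddingB u u' : psi (u - u') = psi u - psi u'.
Proof.
have [lin _ _ _] := hpsi.
by rewrite -scaleN1r addrC lin scaleN1r addrC.
Qed.

Lemma embedding_invariant u : invariant (psi u).
Proof. by case: hpsi. Qed.

Lemma embedding_preimage_subspace Y : subspace Y -> subspace (fun u => Y (psi u)).
Proof.
move=> sY; have [lin _ _ _] := hpsi.
split; first by rewrite embedding0; exact: sY.1.
by move=> a u u' hu hu'; rewrite lin; apply: sY.2.
Qed.

(** The preimage of a stable subspace is a subrepresentation. *)
Lemma embedding_sub Y : subspace Y -> right_stable Y ->
  (exists2 u, Y (psi u) & u <> 0) -> forall u, Y (psi u).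
Proof.
move=> sY rY nY; have [_ equ _ _] := hpsi.
apply: (irreducible_subspace irr) => //; first exact: embedding_preimage_subspace.
by move=> A u uA Yu; rewrite equ //; apply: rY.
Qed.

Lemma embedding_eq0 u : psi u = 0 -> u = 0.
Proof.
move=> u0; apply: contrapT => nz; have [_ _ _ [v [nv _]]] := hpsi; apply: nv.
apply: (embedding_sub (Y := fun P => P = 0)) => //; last by exists u.
- by split=> [//|a P Q -> ->]; rewrite scaler0 addr0.
- by move=> A P _ ->.
Qed.

Definition component P : Prop := exists u, P = psi u.

Lemma component_subspace : subspace component.
Proof.
have [lin _ _ _] := hpsi; split; first by exists 0; rewrite embedding0.
by move=> a _ _ [u ->] [u' ->]; exists (a *: u + u'); rewrite lin.
Qed.

Lemma component_right_stable : right_stable component.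
Proof.
have [_ equ _ _] := hpsi => A _ uA [u ->].
by exists (gl_act V A *m u); rewrite equ.
Qed.

Lemma component_invariant P : component P -> invariant P.
Proof. by case=> u ->; apply: embedding_invariant. Qed.

Lemma adjmx_trig (L : jet) : is_trig_mx L -> is_trig_mx (adjmx L)^T.
Proof.
move=> /is_trig_mxP tL; apply/is_trig_mxP => i j ltij.
by rewrite !mxE tL // conjC0.
Qed.

(** Weight vectors of distinct weights are orthogonal, because the torus acts by
    self-adjoint operators. For A = L B in the big cell, translating the highest
    weight vector by A and moving L to the other side multiplies the product by
    a scalar; hence the product vanishes on all translates. *)
Lemma embedding_orthogonal l' Q u : l' <> l -> invariant Q ->
  semi_invariant l' Q -> form (psi u) Q = 0.
Proof.
move=> nll' hQ sQ; have [lin equ hE [v [nzv sv]]] := hpsi.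
have hv : form (psi v) Q = 0.
  have [k nk] : exists k, l' k != l k.
    apply: contrapT => none; apply: nll'; apply/funext => k.
    by apply/eqP; apply: contrapT => /negP nk; apply: none; exists k.
  pose D : jet := torus (fun j => (j == k) : nat) 2.
  have uD : D \in unitmx by apply: torus_unit; rewrite pnatr_eq0.
  have tD : is_trig_mx D^T by rewrite tr_diag_mx diag_mx_is_trig.
  have aD : adjmx D = D.
    apply/matrixP => i j; rewrite !mxE rmorphMn rmorphXn /= conjC_nat.
    have [->//|nij] := eqVneq i j.
    by rewrite !mulr0n.
  have chD l0 : character l0 D = 2 ^+ l0 k.
    rewrite /character (bigD1 k) //= !mxE !eqxx expr1 big1 ?mulr1 // => j nj.
    by rewrite !mxE eqxx (negbTE nj) expr1n.
  have := invariant_form_mulmxr uD (hE v) hQ; rewrite aD.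
  have -> : (fun F => psi v (F *m D)) = 2 ^+ l k *: psi v.
    by apply/funext => F; rewrite sv // chD.
  have -> : (fun F => Q (F *m D)) = 2 ^+ l' k *: Q.
    by apply/funext => F; rewrite sQ // chD.
  rewrite (formZl _ _ _ hform) (formZr _ inv_sub hform) // rmorphXn /= conjC_nat.
  move/eqP; rewrite -subr_eq0 -mulrBl mulf_eq0 => /orP[|/eqP//].
  by rewrite subr_eq0 -!natrX eqr_nat eqn_exp2l // eq_sym (negbTE nk).
have [rho [prho rhoE]] := polynomial_rep_extension hV.
pose eta : 'rV[C]_(gl_dim V) := \row_b form (psi (delta_mx b 0)) Q.
have etaE w : (eta *m w) 0 0 = form (psi w) Q.
  have fl : forall a w1 w2, form (psi (a *: w1 + w2)) Q =
      a * form (psi w1) Q + form (psi w2) Q.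
    by move=> a w1 w2; rewrite lin; case: hform.
  have -> : w = \sum_b w b 0 *: delta_mx b 0.
    rewrite {1}[w]matrix_sum_delta; apply: eq_bigr => b _.
    by rewrite big_ord1.
  rewrite mulmx_sumr summxE.
  elim: (index_enum _) => [|b s IHs].
    by rewrite !big_nil embedding0 (form0l _ hform).
  rewrite !big_cons fl IHs -scalemxAr mxE; congr (_ * _ + _).
  by rewrite -colE !mxE.
have v0 : v <> 0 by move=> v0; apply: nzv; rewrite v0 embedding0.
suff eta0 : eta = 0 by rewrite -etaE eta0 mul0mx mxE.
apply: (matrix_coef_eq0 hV prho rhoE irr v0).
apply: big_cell_dense; first exact: polynomial_fun_matrix_coef.
move=> L B uL tL uB tB.
have uLB : L *m B \in unitmx by rewrite unitmx_mul uL uB.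
rewrite /matrix_coef rhoE // -mulmxA etaE equ //.
have -> : (fun F => psi v (F *m (L *m B))) =
    character l B *: (fun F => psi v (F *m L) : C^o).
  by apply/funext => F; rewrite mulmxA sv.
rewrite (formZl _ _ _ hform) invariant_form_mulmxr //.
have -> : (fun F => Q (F *m adjmx L)) = character l' (adjmx L) *: Q.
  by apply/funext => F; apply: (sQ _ (adjmx_unit uL) (adjmx_trig tL)).
by rewrite (formZr _ inv_sub hform) // hv !mulr0.
Qed.

(** Let Y1 be the part of Y orthogonal to the component. The orthogonal of Y1 in
    Y is nonzero and stable, so it contains a highest weight vector. If the weight
    of this vector were not l, it would be orthogonal to the component, hence
    would belong to Y1 and to its orthogonal. *)
Lemma component_sub Y : subspace Y -> right_stable Y ->
  (forall P, Y P -> invariant P) ->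
  (exists P u, Y P /\ form P (psi u) != 0) -> forall u, Y (psi u).
Proof.
move=> sY rY YE [P [u0 [YP nPu]]].
pose Y1 Q := Y Q /\ forall Q', component Q' -> form Q Q' = 0.
have sY1 : subspace Y1 by apply: orthogonal_subspace.
have rY1 : right_stable Y1.
  by apply: orthogonal_right_stable => //;
     [exact: component_right_stable | exact: component_invariant].
have Y1E Q : Y1 Q -> invariant Q by case=> /YE.
have [P1 Y1P1 oP1] := ortho_projection hform inv_sub invariant_finite_span sY1 Y1E
  (YE _ YP).
pose Y2 Q := Y Q /\ forall Q', Y1 Q' -> form Q Q' = 0.
have sY2 : subspace Y2 by apply: orthogonal_subspace.
have rY2 : right_stable Y2 by apply: orthogonal_right_stable.
have [||l' [N [Y2N nzN sN hl']]] := invariant_highest_weight sY2 rY2.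
- by move=> Q [/YE].
- exists (P - P1).
    by split=> //; apply: subspaceB => //; case: Y1P1.
  move=> e0; move/eqP: nPu; apply; move/eqP: e0; rewrite subr_eq0 => /eqP ->.
  by apply: Y1P1.2; exists u0.
have EN : invariant N by apply: YE; case: Y2N.
have ell' : l' = l.
  apply: contrapT => nll'; apply: nzN.
  have Y1N : Y1 N.
    split=> [|_ [u ->]]; first by case: Y2N.
    apply: (form_eq0C hform) => //; first exact: embedding_invariant.
    exact: (embedding_orthogonal _ nll').
  by have [_ _] := hform; apply => //; apply: Y2N.2.
have [_ _ hE [v [nzv sv]]] := hpsi; rewrite ell' in sN.
have [c ev] := highest_jet_proportional EN sN nzN (hE v) sv.
apply: embedding_sub => //; exists v.
  by rewrite ev; apply: subspaceZ => //; case: Y2N.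
by move=> v0; apply: nzv; rewrite v0 embedding0.
Qed.

Definition component_proj P : 'cV[C]_(gl_dim V) :=
  xget 0 [set u | forall u', form (P - psi u) (psi u') = 0].

Lemma component_projP P u' : invariant P ->
  form (P - psi (component_proj P)) (psi u') = 0.
Proof.
move=> hP; have [_ [u ->] hu] := ortho_projection hform inv_sub
  invariant_finite_span component_subspace component_invariant hP.
have : exists u, forall u', form (P - psi u) (psi u') = 0.
  by exists u => w; apply: hu; exists w.
by move=> h; have := xgetPex (0 : 'cV[C]_(gl_dim V)) h; apply.
Qed.

Lemma component_proj_unique P u : invariant P ->
  (forall u', form (P - psi u) (psi u') = 0) -> component_proj P = u.
Proof.
move=> hP hu; apply/eqP; rewrite -subr_eq0; apply/eqP.
apply: embedding_eq0; set w := _ - _.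
have [_ _ hd] := hform; apply: hd; first exact: embedding_invariant.
have {1}-> : psi w = (P - psi u) - (P - psi (component_proj P)).
  by rewrite /w embeddingB opprB [RHS]addrC addrA subrK.
by rewrite (formBl _ _ _ hform) hu component_projP // subrr.
Qed.

Lemma component_proj_linear a P P' : invariant P -> invariant P' ->
  component_proj (a *: P + P') = a *: component_proj P + component_proj P'.
Proof.
move=> hP hP'; apply: component_proj_unique; first exact: inv_sub.2.
move=> u'; have [lin _ _ _] := hpsi.
have -> : a *: P + P' - psi (a *: component_proj P + component_proj P') =
    a *: (P - psi (component_proj P)) + (P' - psi (component_proj P')).
  by rewrite lin scalerBr opprD addrACA.
by rewrite (formDl _ _ _ hform) (formZl _ _ _ hform) !component_projP // mulr0 addr0.
Qed.

Lemma component_proj_mulmxr A P : A \in unitmx -> invariant P ->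
  component_proj (fun F => P (F *m A)) = gl_act V A *m component_proj P.
Proof.
move=> uA hP; have [_ equ _ _] := hpsi.
apply: component_proj_unique; first exact: invariant_jet_right_stable.
move=> u'; rewrite equ //.
rewrite -[X in form X _]/(fun F => (P - psi (component_proj P)) (F *m A)).
rewrite invariant_form_mulmxr //; last exact: embedding_invariant.
  by rewrite -equ ?adjmx_unit //; apply: component_projP.
by apply: subspaceB => //; apply: embedding_invariant.
Qed.

Lemma component_proj_embedding u : component_proj (psi u) = u.
Proof.
apply: component_proj_unique; first exact: embedding_invariant.
by move=> u'; rewrite subrr (form0l _ hform).
Qed.

Lemma component_proj_eq0 P : invariant P ->
  component_proj P = 0 <-> forall u, form P (psi u) = 0.
Proof.
move=> hP; split=> [p0 u|h0].
  by have := component_projP u hP; rewrite p0 embedding0 subr0.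
by apply: component_proj_unique => // u; rewrite embedding0 subr0.
Qed.

End OneComponent.

Lemma embeddings_orthogonal l l' (V V' : gl_module R 3) psi psi' u u' :
  polynomial_rep V -> irreducible_rep V -> irreducible_rep V' ->
  @jet_embedding l V psi -> @jet_embedding l' V' psi' -> l' <> l ->
  form (psi u) (psi' u') = 0.
Proof.
move=> hV irr irr' hpsi hpsi' nll'.
apply: (form_eq0C hform); [exact: (embedding_invariant hpsi')
                          |exact: (embedding_invariant hpsi)|].
have [_ _ hE [v [nzv sv]]] := hpsi'.
pose Y P := invariant P /\ forall Q, component psi Q -> form P Q = 0.
suff h : forall w, Y (psi' w) by apply: (h u').2; exists u.
apply: (embedding_sub irr' hpsi').
- exact: orthogonal_subspace.
- apply: orthogonal_right_stable => //.
  + exact: invariant_jet_right_stable.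
  + exact: (component_right_stable hpsi).
  + exact: (component_invariant hpsi).
- exists v; last by move=> v0; apply: nzv; rewrite v0 (embedding0 hpsi').
  split=> // _ [w ->]; apply: (form_eq0C hform) => //.
    exact: (embedding_invariant hpsi).
  exact: (embedding_orthogonal hV irr hpsi _ nll').
Qed.

End Components.

(** * The filtration by the degrees in f''' and f'' *)

Section Filtration.
Variable R : realType.
Local Notation C := (Cplx R).
Local Notation jet := 'M[C]_3.
Implicit Types (P Q : jet -> C^o) (F : jet) (e : 'M[nat]_3) (l : nat * nat).

Lemma lex_lt_le a b : lex_lt a b -> lex_le a b.
Proof. by rewrite /lex_le => ->; rewrite orbT. Qed.

Lemma lex_le_trans a b c : lex_le a b -> lex_le b c -> lex_le a c.
Proof.
by case: a b c => [a a'] [b b'] [c c']; rewrite /lex_le /lex_lt !xpair_eqE /=; lia.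
Qed.

Lemma lex_le_lt_trans a b c : lex_le a b -> lex_lt b c -> lex_lt a c.
Proof.
by case: a b c => [a a'] [b b'] [c c']; rewrite /lex_le /lex_lt !xpair_eqE /=; lia.
Qed.

Lemma lex_lt_le_trans a b c : lex_lt a b -> lex_le b c -> lex_lt a c.
Proof.
by case: a b c => [a a'] [b b'] [c c']; rewrite /lex_le /lex_lt !xpair_eqE /=; lia.
Qed.

Lemma lex_leD a b a' b' : lex_le a b -> lex_le a' b' -> lex_le (a + a') (b + b').
Proof.
case: a b a' b' => [a1 a2] [b1 b2] [c1 c2] [d1 d2].
by rewrite /lex_le /lex_lt !xpair_eqE /=; lia.
Qed.

Lemma lex_ltD a b a' b' : lex_lt a b -> lex_le a' b' -> lex_lt (a + a') (b + b').
Proof.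
case: a b a' b' => [a1 a2] [b1 b2] [c1 c2] [d1 d2].
by rewrite /lex_le /lex_lt !xpair_eqE /=; lia.
Qed.

Lemma lex_total a b : lex_le a b \/ lex_lt b a.
Proof.
by case: a b => [a a'] [b b']; rewrite /lex_le /lex_lt !xpair_eqE /=; lia.
Qed.

Definition lex_degree e : nat * nat := (row_degree 2 e, row_degree 1 e).

Lemma lex_degreeD e e' : lex_degree (e + e') = lex_degree e + lex_degree e'.
Proof.
by congr pair; rewrite /row_degree -big_split; apply: eq_bigr => j _; rewrite mxE.
Qed.

Lemma lex_degree0 : lex_degree 0 = 0.
Proof. by congr pair; rewrite /row_degree big1 // => j _; rewrite mxE. Qed.

Definition row_level (i : 'I_3) : nat * nat :=
  nth (0, 0)%N [:: (0, 0); (0, 1); (1, 0)]%N i.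

Lemma lex_degree_delta i j : lex_degree (delta_mx i j) = row_level i.
Proof.
rewrite /lex_degree /row_degree !(bigD1 (P := xpredT) j) //= !mxE eqxx !andbT.
rewrite big1 => [|k /negbTE nk]; last by rewrite mxE nk andbF.
rewrite big1 => [|k /negbTE nk]; last by rewrite mxE nk andbF.
by move: i; apply: ord3P.
Qed.

Lemma lex_degreeE e : lex_degree e = \sum_i \sum_j row_level i *+ e i j.
Proof.
under eq_bigr => i _ do rewrite sumrMnr.
rewrite sum3 /row_level /=.
have e2 n : (1, 0)%N *+ n = (n, 0)%N :> nat * nat.
  by elim: n => // n IHn; rewrite mulrS IHn; congr pair.
have e1 n : (0, 1)%N *+ n = (0, n)%N :> nat * nat.
  by elim: n => // n IHn; rewrite mulrS IHn; congr pair.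
have e0 n : (0, 0)%N *+ n = (0, 0)%N :> nat * nat.
  by elim: n => // n IHn; rewrite mulrS IHn; congr pair.
by rewrite e0 e1 e2; congr pair; rewrite /= addr0 add0r.
Qed.

Let le_deg l : pred 'M[nat]_3 := fun e => lex_le (lex_degree e) l.
Let lt_deg l : pred 'M[nat]_3 := fun e => lex_lt (lex_degree e) l.

Lemma le_degM l l' P Q : polynomial_in (le_deg l) P -> polynomial_in (le_deg l') Q ->
  polynomial_in (le_deg (l + l')) (fun F => P F * Q F).
Proof.
by apply: polynomial_inM => e e' h h'; rewrite /le_deg lex_degreeD; apply: lex_leD.
Qed.

Lemma lt_degM l l' P Q : polynomial_in (lt_deg l) P -> polynomial_in (le_deg l') Q ->
  polynomial_in (lt_deg (l + l')) (fun F => P F * Q F).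
Proof.
by apply: polynomial_inM => e e' h h'; rewrite /lt_deg lex_degreeD; apply: lex_ltD.
Qed.

Lemma le_deg_entry i j : polynomial_in (le_deg (row_level i)) (fun F : jet => F i j).
Proof.
by apply: polynomial_in_entry; rewrite /le_deg lex_degree_delta /lex_le eqxx.
Qed.

Lemma le_deg_lt l l' P : lex_lt l l' -> polynomial_in (le_deg l) P ->
  polynomial_in (lt_deg l') P.
Proof.
move=> h; apply: sub_polynomial_in => e; rewrite !unfold_in => h'.
exact: lex_le_lt_trans h' h.
Qed.

(** Congruence modulo terms of lower degree; recording the bounds on both sides
    makes it compatible with products. *)
Definition same_lead l P P' : Prop :=
  [/\ polynomial_in (le_deg l) P, polynomial_in (le_deg l) P'
    & polynomial_in (lt_deg l) (fun F => P F - P' F)].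

Lemma same_leadM l l' P P' Q Q' : same_lead l P P' -> same_lead l' Q Q' ->
  same_lead (l + l') (fun F => P F * Q F) (fun F => P' F * Q' F).
Proof.
move=> [hP hP' hPP'] [hQ hQ' hQQ']; split; try exact: le_degM.
have -> : (fun F => P F * Q F - P' F * Q' F) =
    (fun F => (P F - P' F) * Q F + (Q F - Q' F) * P' F).
  by apply/funext => F; ring.
apply: polynomial_inD; first exact: lt_degM.
by rewrite addrC; apply: lt_degM.
Qed.

Lemma same_lead_refl l P : polynomial_in (le_deg l) P -> same_lead l P P.
Proof.
move=> hP; split=> //.
by under [X in polynomial_in _ X]eq_fun do rewrite subrr; apply: polynomial_in0.
Qed.

Lemma same_lead_one : same_lead 0 (fun _ => 1) (fun _ => 1).
Proof.
apply: same_lead_refl; apply: polynomial_in_cst.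
by rewrite /le_deg lex_degree0.
Qed.

Lemma same_leadX l P P' n : same_lead l P P' ->
  same_lead (l *+ n) (fun F => P F ^+ n) (fun F => P' F ^+ n).
Proof.
move=> h; elim: n => [|n IHn]; first by rewrite mulr0n; apply: same_lead_one.
rewrite mulrS; have := same_leadM h IHn.
by congr (same_lead _ _ _); apply/funext => F; rewrite exprS.
Qed.

Lemma same_lead_prod (I : Type) (s : seq I) (l : I -> nat * nat)
    (P P' : I -> jet -> C) : (forall i, same_lead (l i) (P i) (P' i)) ->
  same_lead (\sum_(i <- s) l i) (fun F => \prod_(i <- s) P i F)
    (fun F => \prod_(i <- s) P' i F).
Proof.
move=> h; elim: s => [|i s IHs].
  rewrite big_nil; have := same_lead_one.
  by congr (same_lead _ _ _); apply/funext => F; rewrite big_nil.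
rewrite big_cons; have := same_leadM (h i) IHs.
by congr (same_lead _ _ _); apply/funext => F; rewrite big_cons.
Qed.

Lemma same_lead_monomial (phi phi' : jet -> jet) e :
  (forall i j, same_lead (row_level i) (fun F => phi F i j) (fun F => phi' F i j)) ->
  same_lead (lex_degree e) (fun F => monomial e (phi F)) (fun F => monomial e (phi' F)).
Proof.
move=> h; rewrite lex_degreeE; apply: same_lead_prod => i.
by apply: same_lead_prod => j; apply: same_leadX.
Qed.

Lemma polynomial_fun_same_lead (phi phi' : jet -> jet) i j :
  (forall i j, same_lead (row_level i) (fun F => phi F i j) (fun F => phi' F i j)) ->
  polynomial_fun (fun F => phi F i j).
Proof. by move=> h; have [hi _ _] := h i j; apply: polynomial_fun_in hi. Qed.

Lemma same_lead_filtration (phi phi' : jet -> jet) l Q :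
  (forall i j, same_lead (row_level i) (fun F => phi F i j) (fun F => phi' F i j)) ->
  jet_filtration l Q ->
  jet_filtration_lt l (fun F => Q (phi F) - Q (phi' F)).
Proof.
move=> h [s hs eQ].
have -> : (fun F => Q (phi F) - Q (phi' F)) =
    (fun F => \sum_(u <- s) u.1 * (monomial u.2 (phi F) - monomial u.2 (phi' F))).
  apply/funext => F; rewrite !eQ -sumrB.
  by apply: eq_bigr => u _; rewrite mulrBr.
rewrite /jet_filtration_lt; elim: s hs {eQ} => [_|u s IHs /= /andP[hu /IHs h']].
  by under [X in polynomial_in _ X]eq_fun do rewrite big_nil; apply: polynomial_in0.
under [X in polynomial_in _ X]eq_fun do rewrite big_cons.
apply: polynomial_inD => //; apply: polynomial_inZ.
have [_ _] := same_lead_monomial u.2 h; apply: sub_polynomial_in => e.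
by rewrite !unfold_in => h''; apply: lex_lt_le_trans h'' hu.
Qed.

Lemma jet_filtration_subspace l : subspace (@jet_filtration R l : (jet -> C^o) -> Prop).
Proof. exact: polynomial_in_subspace. Qed.

Lemma jet_filtration_lt_subspace l :
  subspace (@jet_filtration_lt R l : (jet -> C^o) -> Prop).
Proof. exact: polynomial_in_subspace. Qed.

Lemma polynomial_in_right_stable (D : pred 'M[nat]_3) (A : jet) Q :
  (forall e l, D e -> lex_le l (lex_degree e) -> forall e', lex_degree e' = l -> D e') ->
  polynomial_in D Q -> polynomial_in D (fun F => Q (F *m A)).
Proof.
move=> hD [s hs eQ].
have h i j : same_lead (row_level i) (fun F : jet => (F *m A) i j)
    (fun F => (F *m A) i j).
  apply: same_lead_refl; under [X in polynomial_in _ X]eq_fun do rewrite mxE.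
  apply: polynomial_in_sum => k.
  under [X in polynomial_in _ X]eq_fun do rewrite mulrC.
  by apply: polynomial_inZ; apply: le_deg_entry.
under [X in polynomial_in _ X]eq_fun do rewrite eQ.
elim: s hs {eQ} => [_|u s IHs /= /andP[hu /IHs h']].
  by under [X in polynomial_in _ X]eq_fun do rewrite big_nil; apply: polynomial_in0.
under [X in polynomial_in _ X]eq_fun do rewrite big_cons.
apply: polynomial_inD => //; apply: polynomial_inZ.
have [+ _ _] := same_lead_monomial u.2 h; apply: sub_polynomial_in => e.
by rewrite !unfold_in => h''; apply: (hD _ _ hu h'').
Qed.

Lemma jet_filtration_right_stable l :
  right_stable (@jet_filtration R l : (jet -> C^o) -> Prop).
Proof.
move=> A Q _; apply: polynomial_in_right_stable => e l' h h' e' h''.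
by rewrite -/(lex_degree e') h''; apply: lex_le_trans h' h.
Qed.

Lemma jet_filtration_lt_right_stable l :
  right_stable (@jet_filtration_lt R l : (jet -> C^o) -> Prop).
Proof.
move=> A Q _; apply: polynomial_in_right_stable => e l' h h' e' h''.
by rewrite -/(lex_degree e') h''; apply: lex_le_lt_trans h' h.
Qed.

Lemma jet_filtration_ltW l l' Q : lex_lt l l' ->
  jet_filtration l Q -> jet_filtration_lt l' Q.
Proof. exact: le_deg_lt. Qed.

Lemma weight_row_degree m e i : weight jet_weight e = m -> (row_degree i e <= m)%N.
Proof.
move=> <-; rewrite /weight (bigD1 i) //= /row_degree.
apply: leq_trans (leq_addr _ _); apply: leq_sum => j _.
by rewrite mxE leq_pmull.
Qed.

Lemma invariant_jet_filtration_top m Q : invariant_jet_differential m Q ->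
  jet_filtration (m, m) Q.
Proof.
move=> hQ; have := invariant_jet_weight hQ.1 hQ; apply: sub_polynomial_in => e.
rewrite !unfold_in /= => /eqP he.
have := weight_row_degree 1 he; have := weight_row_degree 2 he.
by rewrite /lex_le /lex_lt xpair_eqE /=; lia.
Qed.

(** The weight bounds the degrees of the monomials, so the largest degree which
    occurs in Q is a step of the finite filtration. *)
Lemma invariant_jet_filtration_lt m Q l : invariant_jet_differential m Q -> Q <> 0 ->
  jet_filtration_lt l Q ->
  exists l' : nat * nat, [/\ (l'.1 <= m)%N, (l'.2 <= m)%N, lex_lt l' l
                            & jet_filtration l' Q].
Proof.
move=> hQ nz flt; have [s hs eQ] := invariant_jet_weight flt hQ.
case: s hs eQ => [_ eQ|u s hs eQ].
  by case: nz; apply/funext => F; rewrite eQ big_nil.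
have [u0 u0s hu0] : exists2 u0, u0 \in u :: s &
    forall v, v \in u :: s -> lex_le (lex_degree v.2) (lex_degree u0.2).
  elim: (s) u {hs eQ} => [|u' s' IHs] u.
    by exists u; rewrite ?mem_head // => v; rewrite inE => /eqP ->; rewrite /lex_le eqxx.
  have [v0 v0s hv0] := IHs u'.
  have [le|/lex_lt_le lt] := lex_total (lex_degree u.2) (lex_degree v0.2).
    exists v0; first by rewrite inE v0s orbT.
    by move=> v; rewrite inE => /orP[/eqP ->|/hv0].
  exists u; first exact: mem_head.
  move=> v; rewrite inE => /orP[/eqP ->|/hv0 h]; first by rewrite /lex_le eqxx.
  exact: lex_le_trans h lt.
have /andP[lt0 /eqP wt0] := allP hs _ u0s.
exists (lex_degree u0.2); split=> //; try exact: weight_row_degree.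
by exists (u :: s) => //; apply/allP.
Qed.

End Filtration.

(** * Coordinate changes *)

Section JetImage.
Variable R : realType.
Local Notation C := (Cplx R).
Local Notation jet := 'M[C]_3.
Variables (t : 'rV[C]_3 -> 'rV[C]_3) (p : 'rV[C]_3).

Definition partial_mx : jet := \matrix_(a, j) partial a t p 0 j.

Lemma jet_image0 F j : jet_image t p F 0 j = \sum_a partial_mx a j * F 0 a.
Proof.
rewrite !mxE /= summxE; apply: eq_bigr => a _.
by rewrite !mxE mulrC.
Qed.

Lemma jet_image1 F j : jet_image t p F 1 j = \sum_a partial_mx a j * F 1 a +
  \sum_a \sum_b partial a (partial b t) p 0 j * (F 0 a * F 0 b).
Proof.
rewrite !mxE /= !summxE; congr (_ + _); apply: eq_bigr => a _.
  by rewrite !mxE mulrC.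
by rewrite summxE; apply: eq_bigr => b _; rewrite !mxE mulrC.
Qed.

Lemma jet_image2 F j : jet_image t p F 2 j = \sum_a partial_mx a j * F 2 a +
  3%:R * (\sum_a \sum_b partial a (partial b t) p 0 j * (F 0 a * F 1 b)) +
  \sum_a \sum_b \sum_c
    partial a (partial b (partial c t)) p 0 j * (F 0 a * F 0 b * F 0 c).
Proof.
rewrite !mxE /= !summxE; congr (_ + _ * _ + _); apply: eq_bigr => a _.
- by rewrite !mxE mulrC.
- by rewrite summxE; apply: eq_bigr => b _; rewrite !mxE mulrC.
- rewrite summxE; apply: eq_bigr => b _.
  by rewrite summxE; apply: eq_bigr => c _; rewrite !mxE mulrC.
Qed.

Lemma mulmx_partialE (F : jet) i j : (F *m partial_mx) i j = \sum_a partial_mx a j * F i a.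
Proof. by rewrite mxE; apply: eq_bigr => a _; rewrite mulrC. Qed.

(** In f'' and f''', the terms involving higher derivatives of t have a smaller
    degree in the derivative of highest order. *)
Lemma jet_image_same_lead i j :
  same_lead (row_level i) (fun F : jet => jet_image t p F i j)
    (fun F : jet => (F *m partial_mx) i j).
Proof.
have lin i' : polynomial_in (fun e : 'M[nat]_3 => lex_le (lex_degree e) (row_level i'))
    (fun F : jet => (F *m partial_mx) i' j).
  under [X in polynomial_in _ X]eq_fun do rewrite mulmx_partialE.
  by apply: polynomial_in_sum => a; apply: polynomial_inZ; apply: le_deg_entry.
have lead l N : polynomial_in (fun e : 'M[nat]_3 => lex_lt (lex_degree e) l) N ->
    forall P P' : jet -> C^o,
    polynomial_in (fun e : 'M[nat]_3 => lex_le (lex_degree e) l) P' ->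
    (forall F, P F = P' F + N F) -> same_lead l P P'.
  move=> hN P P' hP' eP; have -> : P = fun F => P' F + N F by apply/funext.
  split=> //.
    apply: polynomial_inD => //; apply: sub_polynomial_in hN => e.
    exact: lex_lt_le.
  under [X in polynomial_in _ X]eq_fun do rewrite addrAC subrr add0r.
  exact: hN.
move: i; apply: ord3P.
- have -> : (fun F => jet_image t p F 0 j) = (fun F => (F *m partial_mx) 0 j).
    by apply/funext => F; rewrite jet_image0 mulmx_partialE.
  exact: same_lead_refl.
- apply: lead (fun F => \sum_a \sum_b
    partial a (partial b t) p 0 j * (F 0 a * F 0 b)) _ _ _ (lin 1) _; last first.
    by move=> F; rewrite jet_image1 mulmx_partialE.
  do 2![apply: polynomial_in_sum => ?]; apply: polynomial_inZ.
  apply: (le_deg_lt (l := row_level 0 + row_level 0)) => //.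
  by apply: le_degM; apply: le_deg_entry.
- apply: lead (fun F => 3%:R * (\sum_a \sum_b
      partial a (partial b t) p 0 j * (F 0 a * F 1 b)) +
    \sum_a \sum_b \sum_c partial a (partial b (partial c t)) p 0 j *
      (F 0 a * F 0 b * F 0 c)) _ _ _ (lin 2) _; last first.
    by move=> F; rewrite jet_image2 mulmx_partialE addrA.
  apply: polynomial_inD.
    apply: polynomial_inZ; do 2![apply: polynomial_in_sum => ?].
    apply: polynomial_inZ.
    apply: (le_deg_lt (l := row_level 0 + row_level 1)) => //.
    by apply: le_degM; apply: le_deg_entry.
  do 3![apply: polynomial_in_sum => ?]; apply: polynomial_inZ.
  apply: (le_deg_lt (l := row_level 0 + row_level 0 + row_level 0)) => //.
  by apply: le_degM; [apply: le_degM|]; apply: le_deg_entry.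
Qed.

(** The formulas of the chain rule are compatible with reparametrizations term by
    term, whatever the coefficients given by the derivatives of t. *)
Lemma jet_image_reparam a1 a2 a3 F :
  jet_image t p (reparam a1 a2 a3 F) = reparam a1 a2 a3 (jet_image t p F).
Proof.
have r0 (G : jet) j : reparam a1 a2 a3 G 0 j = a1 * G 0 j.
  by rewrite reparamE mxE sum3 !mxE /=; ring.
have r1 (G : jet) j : reparam a1 a2 a3 G 1 j = a2 * G 0 j + a1 ^+ 2 * G 1 j.
  by rewrite reparamE mxE sum3 !mxE /=; ring.
have r2 (G : jet) j : reparam a1 a2 a3 G 2 j =
    a3 * G 0 j + 3%:R * a1 * a2 * G 1 j + a1 ^+ 3 * G 2 j.
  by rewrite reparamE mxE sum3 !mxE /=; ring.
set G := reparam a1 a2 a3 F.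
apply/matrixP => i j.
pose J k := \sum_a partial_mx a j * F k a.
pose H a b := partial a (partial b t) p 0 j.
pose T a b c := partial a (partial b (partial c t)) p 0 j.
have sJ0 : \sum_a partial_mx a j * G 0 a = a1 * J 0.
  by rewrite mulr_sumr; apply: eq_bigr => a _; rewrite r0; ring.
have sJ1 : \sum_a partial_mx a j * G 1 a = a2 * J 0 + a1 ^+ 2 * J 1.
  by rewrite !mulr_sumr -big_split /=; apply: eq_bigr => a _; rewrite r1; ring.
have sJ2 : \sum_a partial_mx a j * G 2 a =
    a3 * J 0 + 3%:R * a1 * a2 * J 1 + a1 ^+ 3 * J 2.
  rewrite !mulr_sumr -!big_split /=; apply: eq_bigr => a _.
  by rewrite r2; ring.
have sH0 : \sum_a \sum_b H a b * (G 0 a * G 0 b) =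
    a1 ^+ 2 * \sum_a \sum_b H a b * (F 0 a * F 0 b).
  rewrite mulr_sumr; apply: eq_bigr => a _; rewrite mulr_sumr.
  by apply: eq_bigr => b _; rewrite !r0; ring.
have sH1 : \sum_a \sum_b H a b * (G 0 a * G 1 b) =
    a1 * a2 * (\sum_a \sum_b H a b * (F 0 a * F 0 b)) +
    a1 ^+ 3 * (\sum_a \sum_b H a b * (F 0 a * F 1 b)).
  rewrite !mulr_sumr -big_split /=; apply: eq_bigr => a _.
  rewrite !mulr_sumr -big_split /=; apply: eq_bigr => b _.
  by rewrite r0 r1 /=; ring.
have sT : \sum_a \sum_b \sum_c T a b c * (G 0 a * G 0 b * G 0 c) =
    a1 ^+ 3 * \sum_a \sum_b \sum_c T a b c * (F 0 a * F 0 b * F 0 c).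
  rewrite mulr_sumr; apply: eq_bigr => a _; rewrite mulr_sumr.
  apply: eq_bigr => b _; rewrite mulr_sumr.
  by apply: eq_bigr => c _; rewrite !r0; ring.
move: i; apply: ord3P.
- by rewrite r0 !jet_image0 sJ0.
- rewrite r1 !jet_image1 jet_image0 sJ1 sH0; rewrite -/(J 0) -/(J 1).
  by set S0 := \sum_a _; ring.
- rewrite r2 !jet_image2 jet_image1 jet_image0 sJ2 sH1 sT.
  rewrite -/(J 0) -/(J 1) -/(J 2).
  set S0 := \sum_a \sum_b H a b * _; set S1 := \sum_a \sum_b H a b * _.
  by set S2 := \sum_a _; ring.
Qed.

Lemma jet_image_invariant m Q : invariant_jet_differential m Q ->
  invariant_jet_differential m (fun F => Q (jet_image t p F)).
Proof.
move=> [pQ hQ]; split=> [|a1 a2 a3 F a10]; last by rewrite jet_image_reparam hQ.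
apply: polynomial_fun_comp => // i j.
exact: (polynomial_fun_same_lead _ _ jet_image_same_lead).
Qed.

End JetImage.

Section Transitions.
Variables (R : realType) (X : complex_threefold R).
Local Notation C := (Cplx R).
Local Open Scope classical_set_scope.

Lemma partial_mx_jacobian (t : 'rV[C]_3 -> 'rV[C]_3) p :
  differentiable t p -> partial_mx t p = jacobian t p.
Proof.
move=> dt; apply/row_matrixP => a; rewrite rowE [in RHS]rowE mul_rV_lin1 -deriveE //.
by apply/rowP => j; rewrite -rowE !mxE.
Qed.

(** Near the point the transition back is a left inverse, so the Jacobian
    matrices are inverse to each other. *)
Lemma transition_unit (i j : chart X) x : chart_dom i x -> chart_dom j x ->
  jacobian (transition i j) (chart_map i x) \in unitmx.
Proof.
have left_unit (A B : 'M[C]_3) : A *m B = 1%:M -> A \in unitmx.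
  by case/mulmx1_unit.
move=> ix jx; set p := chart_map i x.
have ip : (chart_map i @` chart_dom i) p by exists x.
have eij : transition i j p = chart_map j x by rewrite /transition /= chart_mapK.
have dij : differentiable (transition i j) p by apply: chart_transition.
have dji : differentiable (transition j i) (transition i j p).
  by rewrite eij; apply: chart_transition.
have near_id : \near p, (transition j i \o transition i j) p = id p.
  have cont : {for p, continuous (chart_inv i)}.
    have := @chart_inv_continuous _ X i.
    rewrite continuous_open_subspace; last exact: chart_img_open.
    by apply; rewrite inE.
  have nj : nbhs p (chart_inv i @^-1` chart_dom j).
    apply: cont; rewrite chart_mapK //.
    by apply: open_nbhs_nbhs; split=> //; apply: chart_dom_open.
  have ni : nbhs p (chart_map i @` chart_dom i).
    by apply: open_nbhs_nbhs; split=> //; apply: chart_img_open.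
  apply: filterS2 ni nj => q [y iy <-]; rewrite /preimage /= => jy.
  rewrite chart_mapK // in jy.
  by rewrite /transition /= (chart_mapK iy) (chart_mapK jy).
have : jacobian (transition i j) p *m jacobian (transition j i) (transition i j p) = 1%:M.
  apply/row_matrixP => a; rewrite row_mul [in LHS]rowE mul_rV_lin1 mul_rV_lin1 row1.
  rewrite -[LHS]/(('d (transition j i) (transition i j p) \o 'd (transition i j) p) _).
  rewrite -(diff_comp dij dji) -(deriveE _ (differentiable_comp dij dji)).
  by rewrite (near_eq_derive _ near_id) derive_id.
exact: left_unit.
Qed.

End Transitions.

(** * Decomposition of the fibres *)

Section Decomposition.
Variables (R : realType) (m : nat).
Local Notation C := (Cplx R).
Local Notation jet := 'M[C]_3.
Local Notation invariant := (@invariant_jet_differential R m : (jet -> C^o) -> Prop).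

Definition index_weight (k : 'I_#|schur_index m|) : 'I_3 -> nat :=
  fun a => (enum_val k).2 a : nat.

Lemma sum3n (f : 'I_3 -> nat) : (\sum_k f k = f 0%R + f 1%R + f 2%R)%N.
Proof. exact: (sum3 (W := nat) f). Qed.

Lemma schur_indexP (g : 'I_(m %/ 5).+1) (l : {ffun 'I_3 -> 'I_m.+1}) :
  reflect [/\ (l 1%R + g <= l 0%R)%N, (l 2%R + g <= l 1%R)%N
            & m = (l 0%R + 2 * l 1%R + 3 * l 2%R + g)%N]
    ((g, l) \in schur_index m).
Proof.
have leg : (g <= m)%N.
  by apply: leq_trans (leq_div m 5); rewrite -ltnS.
have sumE : (\sum_(i < 3) i.+1 * l i = l 0%R + 2 * l 1%R + 3 * l 2%R)%N.
  by rewrite sum3n mul1n.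
rewrite inE /= sumE; apply: (iffP andP).
  case=> /eqP e /forallP h; split; last by lia.
  - by have /forallP/(_ 1%R) := h 0%R.
  - by have /forallP/(_ 2%R) := h 1%R.
case=> h1 h2 e; split; first by apply/eqP; lia.
apply/forallP; apply: ord3P; apply/forallP; apply: ord3P; apply/implyP => // _.
exact: leq_trans h2 (leq_trans (leq_addr g _) h1).
Qed.

Lemma index_weight_jet k : jet_weights m (index_weight k).
Proof.
have := enum_valP k; rewrite /index_weight; case: (enum_val k) => g l /= /schur_indexP.
by move=> h; exists g.
Qed.

Lemma jet_weights_index l : jet_weights m l -> exists k, index_weight k = l.
Proof.
move=> [g [h1 h2 em]].
have lel a : (l a < m.+1)%N by move: a; apply: ord3P; lia.
have leg : (g < (m %/ 5).+1)%N by rewrite ltnS leq_divRL //; lia.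
pose l' : {ffun 'I_3 -> 'I_m.+1} := [ffun a => Ordinal (lel a)].
have hin : (Ordinal leg, l') \in schur_index m.
  by apply/schur_indexP; rewrite !ffunE.
exists (enum_rank_in hin (Ordinal leg, l')); apply/funext => a.
by rewrite /index_weight enum_rankK_in //= ffunE.
Qed.

(** The weight equation determines gamma from lambda: there is no multiplicity. *)
Lemma index_weight_inj : injective index_weight.
Proof.
move=> k k' e; apply: enum_val_inj; have := enum_valP k; have := enum_valP k'.
move: e; rewrite /index_weight.
case: (enum_val k) (enum_val k') => [g l] [g' l'] /= e.
move=> /schur_indexP[_ _ em'] /schur_indexP[_ _ em].
have el a : l a = l' a by apply: val_inj; apply: (congr1 (fun f => f a) e).
congr pair; last exact/ffunP.
apply: val_inj; move: em; rewrite !el => em.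
exact: addnI (etrans (esym em) em').
Qed.

Variable Gamma : ('I_3 -> nat) -> gl_module R 3.
Hypothesis hGamma : schur_functors Gamma.

Lemma index_weight_dominant k : dominant (index_weight k).
Proof.
have [g [h1 h2 _]] := index_weight_jet k.
by apply: ord3P; apply: ord3P => //= _; lia.
Qed.

Let hG k := hGamma (index_weight_dominant k).

Lemma component_embedding k :
  {psi : 'cV[C]_(gl_dim (Gamma (index_weight k))) -> jet -> C^o
       | jet_embedding m (index_weight k) psi}.
Proof.
apply: cid; have [hV irr hw] := hG k.
exact: jet_embedding_exists hV irr hw (index_weight_jet k).
Qed.

Definition embed k := projT1 (component_embedding k).
Arguments embed k u : clear implicits.

Lemma embedP k : jet_embedding m (index_weight k) (embed k).
Proof. exact: projT2 (component_embedding k). Qed.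

Definition project k : (jet -> C^o) -> 'cV[C]_(gl_dim (Gamma (index_weight k))) :=
  component_proj m (embed k).

Lemma project_embed k k' u : k != k' -> project k' (embed k u) = 0.
Proof.
move=> nk; have [hV irr _] := hG k; have [hV' irr' _] := hG k'.
apply/(component_proj_eq0 irr' (embedP k')).
  exact: (embedding_invariant (embedP k)).
move=> u'; apply: (embeddings_orthogonal u u' hV irr irr' (embedP k) (embedP k')).
by move=> /index_weight_inj /esym/eqP; rewrite (negbTE nk).
Qed.

Lemma project_linear k a P P' : invariant P -> invariant P' ->
  project k (a *: P + P') = a *: project k P + project k P'.
Proof.
by have [_ irr _] := hG k; apply: (component_proj_linear irr (embedP k)).
Qed.

Lemma project0 k : project k 0 = 0.
Proof.
have h0 : invariant 0 := (@invariant_jet_subspace R m).1.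
by have := project_linear k (-1) h0 h0; rewrite scaler0 addr0 scaleN1r addNr.
Qed.

Lemma project_sum k (I : Type) (s : seq I) (D : pred I) (P : I -> jet -> C^o) :
  (forall i, invariant (P i)) ->
  project k (\sum_(i <- s | D i) P i) = \sum_(i <- s | D i) project k (P i).
Proof.
move=> hP; elim: s => [|i s IHs]; first by rewrite !big_nil project0.
rewrite !big_cons; case: ifP => // _.
rewrite -[P i]scale1r project_linear ?scale1r ?IHs //.
exact: (subspace_sum _ (@invariant_jet_subspace R m)).
Qed.

(** The orthogonal of all the components contains no highest weight vector, hence
    is zero. *)
Lemma invariant_jet_decomposition P : invariant P ->
  P = \sum_k embed k (project k P).
Proof.
move=> hP; have sE := @invariant_jet_subspace R m.
have hE k u : invariant (embed k u) := embedding_invariant (embedP k) u.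
set S := \sum_k _.
have hS : invariant S by apply: (subspace_sum _ sE).
pose Z Q := exists k u, Q = embed k u.
pose Y Q := invariant Q /\ forall Q', Z Q' -> kernel_form m Q Q' = 0.
have sY : subspace Y by apply: orthogonal_subspace.
have rY : right_stable Y.
  apply: orthogonal_right_stable => //.
  - exact: invariant_jet_right_stable.
  - move=> A _ uA [k [u ->]]; have [_ equ _ _] := embedP k.
    by exists k, (gl_act _ A *m u); rewrite equ.
  - by move=> _ [k [u ->]].
suff h0 : P - S = 0 by apply/eqP; rewrite -subr_eq0 h0.
apply: contrapT => nz.
have [||l [N [YN nzN sN hl]]] := invariant_highest_weight (m := m) sY rY.
- by move=> Q [].
- exists (P - S) => //; split; first exact: subspaceB.
  move=> _ [k [u ->]]; have [_ irr _] := hG k.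
  apply: (component_proj_eq0 irr (embedP k) _).1; first exact: subspaceB.
  rewrite -/(project k (P - S)) -scaleN1r addrC project_linear //.
  rewrite /S project_sum // (bigD1 k) //= big1 => [|k' nk']; last exact: project_embed.
  rewrite addr0 /project (component_proj_embedding irr (embedP k)).
  by rewrite scaleN1r addNr.
have [k ek] := jet_weights_index hl.
have [_ _ _ [v [nzv sv]]] := embedP k; rewrite ek in sv.
have [c eN] := highest_jet_proportional (hE k v) sv nzv YN.1 sN.
have [_ _ hd] := invariant_form_hermitian R m; apply: nzN; apply: hd; first exact: YN.1.
rewrite {2}eN; apply: YN.2; exists k, (c *: v); have [lin _ _ _] := embedP k.
by rewrite -[c *: v]addr0 lin (embedding0 (embedP k)) addr0.
Qed.

Lemma embed_sub k (Y : (jet -> C^o) -> Prop) P : subspace Y -> right_stable Y ->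
  invariant P -> Y P -> project k P <> 0 -> forall u, Y (embed k u).
Proof.
move=> sY rY hP YP nz; have [hV irr _] := hG k.
have sYE : subspace (fun Q => invariant Q /\ Y Q).
  by apply: subspaceI => //; exact: invariant_jet_subspace.
suff h u : invariant (embed k u) /\ Y (embed k u) by move=> u; case: (h u).
move: u; apply: (component_sub hV irr (embedP k) sYE).
- by move=> A Q uA [hQ YQ]; split; [apply: invariant_jet_right_stable | apply: rY].
- by move=> Q [].
apply: contrapT => none; apply: nz.
apply/(component_proj_eq0 irr (embedP k)) => // u; apply/eqP.
by apply: contrapT => /negP nPu; apply: none; exists P, u.
Qed.

Local Notation level := ('I_m.+1 * 'I_m.+1)%type.
Definition pair_of_level (n : level) : nat * nat := (n.1 : nat, n.2 : nat).

(** The step of the filtration in which the component k appears. *)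
Definition is_level k (n : level) : Prop :=
  (forall u, jet_filtration (pair_of_level n) (embed k u)) /\
  forall n' : level, lex_lt (pair_of_level n') (pair_of_level n) ->
    ~ forall u, jet_filtration (pair_of_level n') (embed k u).

Lemma level_exists k : exists n, is_level k n.
Proof.
pose good (n : level) := `[< forall u, jet_filtration (pair_of_level n) (embed k u) >].
have good_max : good (ord_max, ord_max).
  apply/asboolP => u; apply: invariant_jet_filtration_top.
  exact: (embedding_invariant (embedP k)).
case: (arg_minnP (fun n : level => n.1 * m.+1 + n.2)%N good_max).
move=> n /asboolP hn hmin; exists n; split=> // n' lt /asboolP /hmin.
move: lt; rewrite /lex_lt /pair_of_level /=.
have := ltn_ord n.2; have := ltn_ord n'.2.
set a := nat_of_ord n.1; set b := nat_of_ord n.2.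
set a' := nat_of_ord n'.1; set b' := nat_of_ord n'.2.
move=> hb' hb /orP[lta|/andP[/eqP -> ltb]]; last by lia.
have : (a'.+1 * m.+1 <= a * m.+1)%N by rewrite leq_mul2r lta orbT.
by rewrite mulSn; lia.
Qed.

Definition level_of k : level := projT1 (cid (level_exists k)).
Lemma level_ofP k : is_level k (level_of k).
Proof. exact: projT2 (cid (level_exists k)). Qed.

(** Otherwise the whole component would lie in the strict part of its step, hence
    in a smaller step. *)
Lemma project_filtration_lt k P : invariant P ->
  jet_filtration_lt (pair_of_level (level_of k)) P -> project k P = 0.
Proof.
move=> hP flt; apply: contrapT => nz.
have h := embed_sub (@jet_filtration_lt_subspace R _)
  (@jet_filtration_lt_right_stable R _) hP flt nz.
have [_ _ hE [v [nzv _]]] := embedP k; have [_ irr _] := hG k.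
have [n' [le1 le2 lt fv]] := invariant_jet_filtration_lt (hE v) nzv (h v).
have := (level_ofP k).2 (Ordinal (le1 : (n'.1 < m.+1)%N), Ordinal (le2 : (n'.2 < m.+1)%N)).
have en : pair_of_level (Ordinal (le1 : (n'.1 < m.+1)%N), Ordinal (le2 : (n'.2 < m.+1)%N)) = n'.
  by rewrite /pair_of_level /=; case: (n').
rewrite en; apply=> //.
apply: (embedding_sub irr (embedP k) (@jet_filtration_subspace R n')).
  exact: jet_filtration_right_stable.
by exists v => // v0; apply: nzv; rewrite v0 (embedding0 (embedP k)).
Qed.

Lemma project_filtration k n P : invariant P ->
  jet_filtration (pair_of_level n) P -> project k P <> 0 ->
  lex_le (pair_of_level (level_of k)) (pair_of_level n).
Proof.
move=> hP fP nz.
have h := embed_sub (@jet_filtration_subspace R _)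
  (@jet_filtration_right_stable R _) hP fP nz.
have [//|lt] := lex_total (pair_of_level (level_of k)) (pair_of_level n).
by case: ((level_ofP k).2 n lt).
Qed.

End Decomposition.
Arguments embed {R m Gamma} hGamma k u.

(** * The graded bundle *)

Section GradedProjection.
Variables (R : realType) (m : nat) (Gamma : ('I_3 -> nat) -> gl_module R 3).
Hypothesis hGamma : schur_functors Gamma.
Local Notation C := (Cplx R).
Local Notation jet := 'M[C]_3.
Local Notation level := ('I_m.+1 * 'I_m.+1)%type.
Local Notation graded := (level -> jet -> C^o).

Definition graded_num (Q : graded) : Prop := forall n : level,
  invariant_jet_differential m (Q n) /\ jet_filtration (pair_of_level n) (Q n).

Definition graded_den (Q : graded) : Prop := forall n : level,
  invariant_jet_differential m (Q n) /\ jet_filtration_lt (pair_of_level n) (Q n).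

Definition graded_project k (Q : graded) :=
  project hGamma k (Q (level_of hGamma k)).

(** The terms of lower order of the coordinate change lie in the part of the
    filtration killed by the projection. *)
Lemma graded_project_transition k (t : 'rV[C]_3 -> 'rV[C]_3) p (Q : graded) :
  partial_mx t p \in unitmx -> graded_num Q ->
  graded_project k (fun n F => Q n (jet_image t p F)) =
  gl_act (Gamma (index_weight k)) (partial_mx t p) *m graded_project k Q.
Proof.
move=> uJ hQ; rewrite /graded_project; set n := level_of hGamma k.
have [hE hF] := hQ n.
pose Q1 F := Q n (F *m partial_mx t p).
pose D F := Q n (jet_image t p F) - Q1 F.
have hQ1 : invariant_jet_differential m Q1 by apply: invariant_jet_right_stable.
have hQ2 := jet_image_invariant t p hE.
have hD : invariant_jet_differential m D.
  exact: (subspaceB (@invariant_jet_subspace R m) hQ2 hQ1).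
have eQ2 : (fun F => Q n (jet_image t p F)) = 1 *: (D : jet -> C^o) + Q1.
  by apply/funext => F; rewrite scale1r -[RHS]/(D F + Q1 F) /D subrK.
have D0 : project hGamma k D = 0.
  apply: project_filtration_lt => //.
  exact: (same_lead_filtration (jet_image_same_lead t p) hF).
rewrite eQ2 project_linear // D0 scaler0 add0r.
have [_ irr _] := hGamma (index_weight_dominant k).
exact: (component_proj_mulmxr irr (embedP hGamma k) uJ hE).
Qed.

(** An element of the step n is the sum of its components, all of them in this
    step; those which appear there are killed exactly when only components of
    smaller steps remain. *)
Lemma graded_project_eq0 (Q : graded) : graded_num Q ->
  (forall k, graded_project k Q = 0) <-> graded_den Q.
Proof.
move=> hQ; split=> [h0 n|hQ' k]; last first.
  by have [hE hlt] := hQ' (level_of hGamma k); apply: project_filtration_lt.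
have [hE hF] := hQ n; split=> //.
rewrite (invariant_jet_decomposition hGamma hE).
apply: (subspace_sum _ (@jet_filtration_lt_subspace R _)) => k _.
have [p0|/eqP nz] := eqVneq (project hGamma k (Q n)) 0.
  rewrite p0 (embedding0 (embedP hGamma k)).
  exact: (@jet_filtration_lt_subspace R _).1.
have := project_filtration hE hF nz.
rewrite /lex_le => /orP[/eqP e|lt].
  case: nz; suff -> : n = level_of hGamma k by apply: h0.
  move: e; rewrite /pair_of_level; case: (level_of _ _) (n) => [a b] [a' b'] /= [ea eb].
  by congr pair; apply: val_inj.
by apply: jet_filtration_ltW lt _; apply: (level_ofP hGamma k).1.
Qed.

Lemma graded_project_surj (v : forall k, 'cV[C]_(gl_dim (Gamma (@index_weight m k)))) :
  exists2 Q, graded_num Q & forall k, graded_project k Q = v k.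
Proof.
have hE (k : 'I_#|schur_index m|) := embedding_invariant (embedP hGamma k).
exists (fun n : level => \sum_(k | level_of hGamma k == n) embed hGamma k (v k)).
  move=> n; split.
    exact: (subspace_sum _ (@invariant_jet_subspace R m)).
  apply: (subspace_sum _ (@jet_filtration_subspace R _)) => k /eqP <-.
  exact: (level_ofP hGamma k).1.
move=> k; rewrite /graded_project project_sum; last by move=> k'; apply: hE.
rewrite (bigD1 k) //= big1 => [|k' /andP[_ nk']]; last exact: project_embed.
have [_ irr _] := hGamma (index_weight_dominant k).
by rewrite addr0; apply: (component_proj_embedding irr (embedP hGamma k)).
Qed.

End GradedProjection.

Theorem mainTheorem2 (R : realType) (X : complex_threefold R)
    (Gamma : ('I_3 -> nat) -> gl_module R 3)
    (hGamma : schur_functors Gamma) (m : nat) :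
  bundle_isom (graded_jet_bundle X m) (schur_sum X Gamma m).
Proof.
exists (fun _ _ Q => \mxcol_k graded_project hGamma k Q); split.
- move=> i x ix; split.
  + move=> a Q Q' hQ hQ'; apply/mxcolP => k.
    have submxcolZ (B : 'cV_(cc_rank (schur_sum X Gamma m))) :
        submxcol (a *: B) k = a *: submxcol B k.
      by apply/matrixP => r c; rewrite !mxE.
    rewrite submxcolD submxcolZ !mxcolK.
    have [hE _] := hQ (level_of hGamma k); have [hE' _] := hQ' (level_of hGamma k).
    exact: project_linear.
  + move=> Q hQ; rewrite -[sq_den _]/(graded_den Q) -(graded_project_eq0 hGamma hQ).
    split=> [h0 k|h0]; last by apply/mxcolP => k; rewrite mxcolK h0 submxcol0.
    by rewrite -(mxcolK (fun k => graded_project hGamma k Q) k) h0 submxcol0.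
  + move=> v; have [Q hQ eQ] := graded_project_surj hGamma (fun k => submxcol v k).
    by exists Q => //; apply/mxcolP => k; rewrite mxcolK eQ.
- move=> i j x ix jx Q hQ; rewrite mul_mxdiag_mxcol; apply: eq_mxcol => k.
  have dt : differentiable (transition i j) (chart_map i x).
    exact: chart_transition.
  have uJ : partial_mx (transition i j) (chart_map i x) \in unitmx.
    by rewrite partial_mx_jacobian //; apply: transition_unit.
  have := graded_project_transition hGamma k uJ hQ.
  by rewrite (partial_mx_jacobian dt).
- move=> i Q hQ k x ix; exact: differentiable_cst.
Qed.
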